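(* Suppose $Z\in p\mathcal M^m$. Then there exists a copredictable process ${}^{\widehat p}Z$ (vanishing on $\{(t,w):t\ge\beta(w)\}$), unique up to $Q_m$-evanescence, such that for each $Q_m$-copredictable time $T$, $$Q_m(Z_T;\,-\infty<T<\beta)=Q_m({}^{\widehat p}Z_T;\,-\infty<T<\beta).$$
   Context: Setting. $E$ is a Lusin space (homeomorphic to a Borel subset of a compact metrizable space) with Borel $\sigma$-algebra $\mathcal E$; $E_\Delta=E\cup\{\Delta\}$ with $\Delta$ isolated. $(P_t)_{t\ge0}$ is a Borel right semigroup: a semigroup of sub-Markovian kernels on $(E,\mathcal E)$ with $P_0(x,\cdot)=\varepsilon_x$ and $\lim_{t\to0}P_t(x,E)=1$ (extended to a Markovian semigroup on $E_\Delta$ with $\Delta$ a trap) such that for every probability $\mu$ on $E_\Delta$ there is a unique probability on the space of right continuous paths $[0,\infty[\to E_\Delta$ absorbed at $\Delta$ under which the coordinate process is strong Markov with semigroup $(P_t)$ and initial law $\mu$. $m$ is a fixed excessive measure: a $\sigma$-finite measure on $(E,\mathcal E)$ with $mP_t\le m$ for all $t\ge0$. $p\mathcal H$ denotes the $[0,\infty]$-valued $\mathcal H$-measurable functions; $\mathcal B$ is the Borel $\sigma$-algebra of $\mathbb R$. Kuznetsov process. $W$ is the set of $w:\mathbb R\to E_\Delta$ that are $E$-valued and right continuous on an open interval $]\alpha(w),\beta(w)[$ and equal to $\Delta$ off it; for the constant path $[\Delta]$, $\alpha=+\infty,\beta=-\infty$. $Y_t(w)=w(t)$, $\mathcal G^0=\sigma(Y_t;t\in\mathbb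 R)$, $\mathcal G^0_{>t}=\sigma(Y_s;s>t)$. $Q_m$ is the unique measure on $(W,\mathcal G^0)$ not charging $\{[\Delta]\}$ with $Q_m(\alpha<t_1,Y_{t_1}\in dx_1,\dots,Y_{t_n}\in dx_n,t_n<\beta)=m(dx_1)P_{t_2-t_1}(x_1,dx_2)\cdots P_{t_n-t_{n-1}}(x_{n-1},dx_n)$ for $t_1<\dots<t_n$; it is $\sigma$-finite. $\mathcal G^m$ is the $Q_m$-completion of $\mathcal G^0$, and $\mathcal G^m_{>t}$ is generated by $\mathcal G^0_{>t}$ and the $Q_m$-null sets. A process on $\mathbb R\times W$ is $Q_m$-evanescent if for $Q_m$-a.e. $w$ it vanishes for all $t$; $\mathcal M^m$ is the $\sigma$-algebra on $\mathbb R\times W$ generated by processes differing from a $\mathcal B\times\mathcal G^0$-measurable one by a $Q_m$-evanescent one. Copredictability. $\widehat{\mathcal P}^0$ is the $\sigma$-algebra on $\mathbb R\times W$ generated by the $\mathcal B\times\mathcal G^0$-measurable processes $Z$ with $Z_t\in\mathcal G^0_{>t}$ for all $t$, $t\mapsto Z_t$ right continuous, and $Z=0$ on $\{t\ge\beta\}$; $\widehat{\mathcal P}^m$ is defined likewise with $\mathcal G^m,\mathcal G^m_{>t}$ in place of $\mathcal G^0,\mathcal G^0_{>t}$ and right continuity only $Q_m$-a.s. A process is copredictable if it is $\widehat{\mathcal P}^0$-measurable. $T:W\to[-\infty,\infty]$ is a $Q_m$-copredictable time if $\{(t,w):t\le T(w)\}\in\widehat{\mathcal P}^m$. *)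

(* Defs.v *)
From HB Require Import structures.
From mathcomp Require Import all_boot all_order all_algebra.
From mathcomp Require Import all_classical all_reals all_analysis.
From mathcomp Require Import measurable_realfun.

Set Implicit Arguments.
Unset Strict Implicit.
Unset Printing Implicit Defensive.

Import Order.TTheory GRing.Theory Num.Theory.
Import numFieldNormedType.Exports.

Local Open Scope classical_set_scope.
Local Open Scope ring_scope.
Local Open Scope ereal_scope.

Notation borel E := (g_sigma_algebraType (@open E)).

(* The three conditions on f say that f is a homeomorphism onto its range. *)
Definition lusin_space (R : realType) (E : topologicalType) : Prop :=
  exists (K : metricType R) (f : E -> K),
    [/\ compact [set: K], injective f,
        (forall U : set E, open U <-> exists2 V : set K, open V & U = f @^-1` V) &
        <<s @open K >> (range f)].

Definition cemetery (E : Type) : Type := option E.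

Section cemetery_topology.
Variable E : topologicalType.

HB.instance Definition _ := Choice.on (cemetery E).
HB.instance Definition _ := Pointed.on (cemetery E).

(* The topological sum of E and a point. *)
Definition cemetery_open : set_system (cemetery E) :=
  [set A | open ((Some : E -> cemetery E) @^-1` A)].

Let cemetery_openT : cemetery_open setT.
Proof. by rewrite /cemetery_open /= preimage_setT; exact: openT. Qed.

Let cemetery_openI : setI_closed cemetery_open.
Proof.
by move=> A B oA oB; rewrite /cemetery_open /= preimage_setI; exact: openI.
Qed.

Let cemetery_open_bigU (I : Type) (f : I -> set (cemetery E)) :
  (forall i, cemetery_open (f i)) -> cemetery_open (\bigcup_i f i).
Proof.
rewrite /cemetery_open /= preimage_bigcup => of_.
by apply: bigcup_open => i _; exact: of_.
Qed.

HB.instance Definition _ := isOpenTopological.Build (cemetery E)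
  cemetery_openT cemetery_openI cemetery_open_bigU.
End cemetery_topology.

Definition Delta {E : Type} : cemetery E := None.

Section right_paths.
Context {R : realType} {E : topologicalType}.

(* A path on [0, +oo[ is encoded as a function on R that is constant, equal
   to its value at 0, on the negative half-line. *)
Definition is_right_path (w : R -> cemetery E) : Prop :=
  [/\ forall t, (t < 0)%R -> w t = w 0%R,
      forall t, (0 <= t)%R -> w s @[s --> t^'+] --> w t &
      forall s t, (0 <= s)%R -> (s <= t)%R -> w s = Delta -> w t = Delta].

Record right_path := RightPath {
  right_path_fun :> R -> cemetery E ;
  right_pathP : is_right_path right_path_fun }.

Lemma is_right_path_Delta : is_right_path (fun=> Delta).
Proof. by split => // t _; exact: cvg_cst. Qed.

HB.instance Definition _ := gen_eqMixin right_path.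
HB.instance Definition _ := gen_choiceMixin right_path.
HB.instance Definition _ := isPointed.Build right_path
  (RightPath is_right_path_Delta).

Definition right_coord (t : R) (w : right_path) : borel (cemetery E) := w t.

Definition right_path_gen : set_system right_path :=
  \bigcup_(t in [set t : R | (0 <= t)%R])
    preimage_set_system setT (right_coord t) measurable.

Definition right_past (t : R) : set_system right_path :=
  <<s \bigcup_(s in [set s : R | (0 <= s <= t)%R])
        preimage_set_system setT (right_coord s) measurable >>.

Definition right_past_plus (t : R) : set_system right_path :=
  [set A | forall s, (t < s)%R -> right_past s A].

Definition optional_time (T : right_path -> \bar R) : Prop :=
  (forall w, 0 <= T w) /\
  (forall t : R, (0 <= t)%R -> right_past_plus t [set w | T w <= t%:E]).

Definition optional_past (T : right_path -> \bar R) : set_system right_path :=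
  [set A | <<s right_path_gen >> A /\
    forall t : R, (0 <= t)%R -> right_past_plus t (A `&` [set w | T w <= t%:E])].

End right_paths.
Arguments right_path R E : clear implicits.
Arguments right_path_gen R E : clear implicits.

Notation right_space R E := (g_sigma_algebraType (right_path_gen R E)).

Section right_semigroup.
Context {R : realType} {E : ptopologicalType}.
(* Only the kernels [P t] with [0 <= t] are meaningful. *)
Variable P : R -> R.-spker borel E ~> borel E.

(* The Markovian extension to the state space with cemetery, Delta a trap. *)
Definition markov_extension (t : R) (x : cemetery E)
    (B : set (borel (cemetery E))) : \bar R :=
  if x is Some y then
    P t y ((Some : borel E -> borel (cemetery E)) @^-1` B) +
      (1 - P t y setT) * \d_(Delta : borel (cemetery E)) B
  else \d_(Delta : borel (cemetery E)) B.

(* Strong Markov property at the stopping times of the right-continuous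
   filtration (F_{t+}). *)
Definition strong_markov (Pr : probability (right_space R E) R) : Prop :=
  forall T : right_path R E -> \bar R, optional_time T ->
  forall A, optional_past T A ->
  forall (t : R) (B : set (borel (cemetery E))), (0 <= t)%R -> measurable B ->
    Pr (A `&` [set w | T w < +oo /\ B (right_coord (fine (T w) + t)%R w)]) =
    \int[Pr]_(w in A `&` [set w | T w < +oo])
      markov_extension t (right_coord (fine (T w)) w) B.

Definition strong_markov_law (mu : probability (borel (cemetery E)) R)
    (Pr : probability (right_space R E) R) : Prop :=
  strong_markov Pr /\
  (forall B : set (borel (cemetery E)), measurable B ->
     Pr (right_coord 0%R @^-1` B) = mu B).

Definition submarkov_semigroup : Prop :=
  [/\ forall (x : borel E) (A : set (borel E)), measurable A -> P 0%R x A = \d_x A,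
      forall (s t : R) (x : borel E) (A : set (borel E)),
        (0 <= s)%R -> (0 <= t)%R -> measurable A ->
        P (s + t)%R x A = \int[P s x]_y P t y A &
      forall x : borel E, P t x setT @[t --> 0%R^'+] --> 1].

Definition borel_right_semigroup : Prop :=
  submarkov_semigroup /\
  forall mu : probability (borel (cemetery E)) R,
    exists Pr : probability (right_space R E) R,
      strong_markov_law mu Pr /\
      forall Pr' : probability (right_space R E) R, strong_markov_law mu Pr' ->
        forall A, measurable A -> Pr' A = Pr A.

Definition excessive (m : {measure set (borel E) -> \bar R}) : Prop :=
  sigma_finite setT m /\
  forall (t : R) (A : set (borel E)), (0 <= t)%R -> measurable A ->
    \int[m]_x P t x A <= m A.

End right_semigroup.

Section kuznetsov_paths.
Context {R : realType} {E : topologicalType}.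

(* Empty intervals are allowed, which gives the constant path [Delta]. *)
Definition is_kuznetsov_path (w : R -> cemetery E) : Prop :=
  exists a b : \bar R, forall t : R,
    (a < t%:E < b -> w t <> Delta /\ w s @[s --> t^'+] --> w t) /\
    (~ (a < t%:E < b) -> w t = Delta).

Record kuznetsov_path := KuznetsovPath {
  kuznetsov_path_fun :> R -> cemetery E ;
  kuznetsov_pathP : is_kuznetsov_path kuznetsov_path_fun }.

Lemma is_kuznetsov_path_Delta : is_kuznetsov_path (fun=> Delta).
Proof.
by exists +oo, +oo => t; split => // /andP[]; rewrite ltNge leey.
Qed.

HB.instance Definition _ := gen_eqMixin kuznetsov_path.
HB.instance Definition _ := gen_choiceMixin kuznetsov_path.
HB.instance Definition _ := isPointed.Build kuznetsov_path
  (KuznetsovPath is_kuznetsov_path_Delta).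

Definition dead_path : kuznetsov_path := KuznetsovPath is_kuznetsov_path_Delta.

(* The endpoints of the interval on which w is E-valued; the conventions
   ereal_inf set0 = +oo and ereal_sup set0 = -oo match alpha([Delta]) = +oo
   and beta([Delta]) = -oo. *)
Definition birth (w : kuznetsov_path) : \bar R :=
  ereal_inf [set t%:E | t in [set t : R | w t <> Delta]].

Definition death (w : kuznetsov_path) : \bar R :=
  ereal_sup [set t%:E | t in [set t : R | w t <> Delta]].

Definition coord (t : R) (w : kuznetsov_path) : borel (cemetery E) := w t.

Definition G0_gen : set_system kuznetsov_path :=
  \bigcup_(t in [set: R]) preimage_set_system setT (coord t) measurable.

Definition G0_after (t : R) : set_system kuznetsov_path :=
  <<s \bigcup_(s in [set s : R | (t < s)%R])
        preimage_set_system setT (coord s) measurable >>.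

End kuznetsov_paths.
Arguments kuznetsov_path R E : clear implicits.
Arguments G0_gen R E : clear implicits.
Arguments dead_path {R E}.

Notation kuznetsov_space R E := (g_sigma_algebraType (G0_gen R E)).

Section kuznetsov_measure.
Context {R : realType} {E : ptopologicalType}.
Variable P : R -> R.-spker borel E ~> borel E.

(* iterated_kernel t A n k x is the iterated integral over
   A (k+1) * ... * A (k+n) of
   P_{t(k+1) - t(k)}(x, dx_{k+1}) ... P_{t(k+n) - t(k+n-1)}(x_{k+n-1}, dx_{k+n}) *)
Fixpoint iterated_kernel (t : nat -> R) (A : nat -> set (borel E))
    (n k : nat) (x : borel E) : \bar R :=
  if n is n'.+1 then
    \int[P (t k.+1 - t k)%R x]_(y in A k.+1) iterated_kernel t A n' k.+1 y
  else 1.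

(* The finite-dimensional laws are prescribed on measurable rectangles
   A 0 * ... * A n, at times t 0 < ... < t n. *)
Definition kuznetsov_measure (m : {measure set (borel E) -> \bar R})
    (Q : {measure set (kuznetsov_space R E) -> \bar R}) : Prop :=
  Q [set dead_path] = 0 /\
  forall (n : nat) (t : nat -> R) (A : nat -> set (borel E)),
    (forall i, (i < n)%N -> (t i < t i.+1)%R) ->
    (forall i, (i <= n)%N -> measurable (A i)) ->
    Q [set w | [/\ birth w < (t 0%N)%:E,
                   forall i, (i <= n)%N -> (Some @` A i) (coord (t i) w) &
                   (t n)%:E < death w]] =
    \int[m]_(x in A 0%N) iterated_kernel t A n 0 x.

End kuznetsov_measure.

Section copredictable.
Context {R : realType} {E : topologicalType}.
Local Notation W := (kuznetsov_path R E).
Local Notation time := (measurableTypeR R).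

Definition sigma_processes (F : set (R * W -> R)) : set_system (R * W) :=
  <<s \bigcup_(Z in F)
        preimage_set_system setT Z (measurable : set (set time)) >>.

Variable Q : {measure set (kuznetsov_space R E) -> \bar R}.

(* The Q-completion of G^0. *)
Definition Gm : set_system W := completed_algebra_gen Q.

Definition Gm_after (t : R) : set_system W :=
  <<s G0_after t `|` Q.-negligible >>.

(* Two processes differ by a Q-evanescent one. *)
Definition indistinguishable {V : Type} (X Y : R * W -> V) : Prop :=
  {ae Q, forall w : kuznetsov_space R E, forall t : R, X (t, w) = Y (t, w)}.

Definition Mm : set_system (R * W) :=
  sigma_processes [set Z : R * W -> R | exists2 Z' : R * W -> R,
    measurable_fun [set: time * kuznetsov_space R E] (Z' : _ -> time) &
    indistinguishable Z Z'].

Definition adapted (G : R -> set_system W) (Z : R * W -> R) : Prop :=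
  forall t : R, preimage_set_system setT (fun w => Z (t, w))
                  (measurable : set (set time)) `<=` G t.

Definition vanishes_after_death {V : nmodType} (Z : R * W -> V) : Prop :=
  forall (t : R) (w : W), death w <= t%:E -> Z (t, w) = 0%R.

Definition right_continuous_process (Z : R * W -> R) (w : W) : Prop :=
  forall t : R, Z (s, w) @[s --> t^'+] --> Z (t, w).

Definition copredictable0 : set_system (R * W) :=
  sigma_processes [set Z : R * W -> R |
    [/\ measurable_fun [set: time * kuznetsov_space R E] (Z : _ -> time),
        adapted G0_after Z,
        forall w, right_continuous_process Z w &
        vanishes_after_death Z]].

Definition copredictablem : set_system (R * W) :=
  sigma_processes [set Z : R * W -> R |
    [/\ measurable_fun [set: time * g_sigma_algebraType Gm] (Z : _ -> time),
        adapted Gm_after Z,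
        {ae Q, forall w : kuznetsov_space R E, right_continuous_process Z w} &
        vanishes_after_death Z]].

Definition process_measurable (S : set_system (R * W)) (Z : R * W -> \bar R) : Prop :=
  preimage_set_system setT Z (measurable : set (set (\bar R))) `<=` S.

Definition copredictable_time (T : W -> \bar R) : Prop :=
  copredictablem [set z : R * W | z.1%:E <= T z.2].

(* Q(Z_T; -oo < T < beta). T and Z_T are only G^m-measurable in general, hence
   the completed measure; it lives on the Caratheodory sigma-algebra of the
   outer measure Q^*, which is Gm since Q is sigma-finite. *)
Definition integral_at (Z : R * W -> \bar R) (T : W -> \bar R) : \bar R :=
  \int[@completed_measure_extension _ _ _ Q]_(w in [set w : W | -oo < T w < death w])
    Z (fine (T w), w).

Definition copredictable_projection (Z pZ : R * W -> \bar R) : Prop :=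
  [/\ forall z, 0 <= pZ z,
      process_measurable copredictable0 pZ,
      vanishes_after_death pZ &
      forall T : W -> \bar R, copredictable_time T ->
        integral_at Z T = integral_at pZ T].

End copredictable.

(* Main.v *)
Require Import Defs.
From HB Require Import structures.
From mathcomp Require Import all_boot all_order all_algebra.
From mathcomp Require Import all_classical all_reals all_analysis.
From mathcomp Require Import measurable_realfun.
From mathcomp Require Import ring lra.

(**
Read in reverse time, the sigma-algebras G_{>t} form an increasing filtration
whose predictable processes are the copredictable ones. Up to evanescence the
copredictable sigma-algebra is generated by the rectangles [a, b] x F with
F in G_{>b+e} for some e > 0. Finite unions of such rectangles have compact
sections, so Choquet's capacitability argument, applied to the outer measure of
the projection to W, approximates every set of this sigma-algebra from inside
by a decreasing intersection of them. The last exit time from such an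
intersection is a copredictable time whose graph lies in the set; applied to
{X <= q < r <= Y} this gives uniqueness.

For existence consider first Z = 1_F with F in G^0 and a finite measure mu. For
rational u and r let P(u, r) be a positive set of the signed measure
mu(F & .) - r mu on G_{>u}, and let E(r) be the set of the (t, w) such that w
belongs to P(u, r) for rational u > t arbitrarily close to t. The projection is
the supremum of the r 1_{E(r)}. No martingale convergence is needed: if K is an
intersection of finite unions of rectangles contained in E(r) and N is its
projection to W, then exhausting, from the greatest u on, the events {w is in
P(u, r) and u is slightly larger than the last exit time} gives
mu(F & N) >= r mu(N). The complements are handled in the same way with 1_{F^c}.
A Dynkin class argument extends the construction to measurable sets of R x W,
and sigma-finiteness of Q on {Y_s is in B}, for m(B) finite, to Q.
*)

Set Implicit Arguments.
Unset Strict Implicit.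
Unset Printing Implicit Defensive.

Import Order.TTheory GRing.Theory Num.Theory.
Import numFieldNormedType.Exports.

Local Open Scope classical_set_scope.
Local Open Scope ring_scope.
Local Open Scope ereal_scope.

(** * Souslin trees and capacitability *)

(** The projection to [W] of a measurable set need not be measurable. Its size is therefore an outer
    measure, and the sections are built as decreasing intersections with compact fibers, whose
    projection is measurable. The sets [P(u, r)] come from separate Hahn decompositions, each
    determined only up to a null set; nothing makes them nested in [r] or consistent in [u]. This
    does no harm, because the projection is tested only on layers where it lies between two
    rationals, and each of the two bounds needs a single accumulation property. Exceeding [a] puts a
    point into some [E(r)] with [r > a]. Being below [c] puts it outside [E(c)], so that the
    complements of the [P(u, c)] hold at all rational [u] shortly after [t]. The filtration stays
    uncompleted throughout; copredictable sets and times of the completed one are replaced by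
    uncompleted sets at the cost of countably many null sets. *)

Section souslin_trees.
Context {T : Type}.
Implicit Types (J : set_system T) (A : set T).

(* A Souslin scheme as a game: the value of a position is the increasing union of
   the values after the next move. Branches may stutter, so that the trees of a
   countable family can be played in turns without reindexing. *)
Record souslin_tree J A := SouslinTree {
  st_pos : Type ;
  st_root : st_pos ;
  st_next : st_pos -> nat -> st_pos ;
  st_val : st_pos -> set T ;
  st_cover : st_pos -> set T ;
  st_val_root : st_val st_root = A ;
  st_val_next : forall p, st_val p = \bigcup_m st_val (st_next p m) ;
  st_val_next_mono : forall p, {homo (fun m => st_val (st_next p m)) : m n / (m <= n)%N >-> m `<=` n} ;
  st_val_cover : forall p, st_val p `<=` st_cover p ;
  st_coverJ : forall p, J (st_cover p) ;
  st_cover_next : forall p m, st_cover (st_next p m) `<=` st_cover p ;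
  st_cover_branch : forall q : nat -> st_pos, q 0%N = st_root ->
    (forall k, q k.+1 = q k \/ exists m, q k.+1 = st_next (q k) m) ->
    (forall n, exists2 k, (n <= k)%N & exists m, q k.+1 = st_next (q k) m) ->
    \bigcap_k st_cover (q k) `<=` A }.

Definition souslin J A : Prop := inhabited (souslin_tree J A).

Lemma souslin_base J A : J A -> souslin J A.
Proof.
move=> JA; constructor.
exists unit tt (fun=> fun=> tt) (fun=> A) (fun=> A) => //.
- by move=> _; rewrite bigcup_const.
- by move=> _ ? ? _.
- by move=> ? ?.
- by move=> ? ? ?.
- by move=> q _ _ _ x Ax; exact: (Ax 0%N I).
Qed.

Section closure.
Variable J : set_system T.
Hypotheses (JT : J setT) (JI : setI_closed J) (JU : setU_closed J) (J0 : J set0).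

Let chosen_tree (A : nat -> set T) (sA : forall j, souslin J (A j)) :
  exists t : forall j, souslin_tree J (A j), True.
Proof.
have H j : {t : souslin_tree J (A j) | True} by apply: cid; case: (sA j) => t; exists t.
by exists (fun j => projT1 (H j)).
Qed.

(** All trees are played at once: a position records one position per tree and the number of moves
    made, and move [n] is played in the tree [sched n], each tree having its turn infinitely often.
    The cover involves only the trees of index below the number of moves, so it is a finite
    intersection, starting from [setT]. *)
Lemma souslin_bigcap (A : nat -> set T) :
  (forall j, souslin J (A j)) -> souslin J (\bigcap_j A j).
Proof.
move=> sA; have [t _] := chosen_tree sA; constructor.
pose P : Type := (nat * (forall j, st_pos (t j)))%type.
pose sched (n : nat) : nat := if @unpickle (nat * nat)%type n is Some ij then ij.1 else 0%N.
pose nx (p : P) m : P := (p.1.+1, fun j => if j == sched p.1 then st_next (p.2 j) m else p.2 j).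
pose V (p : P) := \bigcap_j st_val (p.2 j).
pose C (p : P) := \bigcap_(j < p.1) st_cover (p.2 j).
exists P (0%N, fun j => st_root (t j)) nx V C => //.
- by apply: eq_bigcapr => j _; rewrite /= st_val_root.
- move=> p; apply/seteqP; split=> [x Vx|x [m _] Vx].
    have := Vx (sched p.1) I; rewrite st_val_next => -[m _ xm]; exists m => // j _ /=.
    by case: eqVneq => [->|_]; [exact: xm|exact: Vx].
  move=> j _; have := Vx j I; rewrite /=; case: eqVneq => // _.
  by move=> xm; rewrite st_val_next; exists m.
- move=> p m n mn x Vx j _; have := Vx j I; rewrite /=; case: eqVneq => // _.
  exact: (st_val_next_mono mn).
- by move=> p x Vx j _; apply: st_val_cover; exact: Vx.
- move=> [n p]; rewrite /C /=; elim: n => [|n IH].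
    by rewrite (_ : \bigcap_(_ < _) _ = setT)// -subTset => x _ j.
  rewrite (_ : \bigcap_(j < n.+1) _ = \bigcap_(j < n) st_cover (p j) `&` st_cover (p n)).
    exact: JI IH (st_coverJ _).
  apply/seteqP; split=> [x Cx|x [Cx xn] j /=].
    by split=> [j /= jn|]; apply: Cx => //=; exact: ltnW.
  by rewrite ltnS leq_eqVlt => /predU1P[->//|]; exact: Cx.
- move=> p m x Cx j /= jp; have := Cx j (ltnW jp); rewrite /=.
  by case: eqVneq => // _; exact: st_cover_next.
move=> q q0 qS qinf x Cx j _.
apply: (@st_cover_branch _ _ (t j) (fun k => (q k).2 j)).
- by rewrite q0.
- move=> k; have [->|[m ->]] := qS k; first by left.
  by rewrite /=; case: eqVneq => _; [right; exists m|left].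
- have q1S k : (q k.+1).1 = (q k).1 \/ (q k.+1).1 = (q k).1.+1.
    by have [->|[m ->]] := qS k; [left|right].
  have q1inf n : exists k, (n <= (q k).1)%N.
    elim: n => [|n [k nk]]; first by exists 0%N.
    have [l kl [m lE]] := qinf k; exists l.+1; rewrite lE /= ltnS.
    rewrite (leq_trans nk)//; elim: l kl {lE} => [|l IH].
      by rewrite leqn0 => /eqP ->.
    rewrite leq_eqVlt => /predU1P[-> //|/IH/leq_trans]; apply.
    by have [->|->] := q1S l.
  (* The counter is unbounded and rises by at most one, so from its value at [N] on it skips
     nothing: every later value [n] is left at some [k], and that step is a genuine move, made in
     the tree [sched n]. *)
  have q1all n N : (n >= (q N).1)%N -> exists2 k, (N <= k)%N & (q k).1 = n /\ (q k.+1).1 = n.+1.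
    move=> nN; have [k nk] := q1inf n.+1.
    have : exists k, ((q (N + k)).1 > n)%N.
      exists k; rewrite (leq_trans nk)//.
      elim: N {nN} => // N /leq_trans; apply; rewrite addSn.
      by have [->|->] := q1S (N + k)%N.
    move/ex_minnP => [[|l]]; first by rewrite addn0 ltnNge nN.
    rewrite addnS => lt_n lmin; exists (N + l)%N; first exact: leq_addr.
    have le_n : ((q (N + l)%N).1 <= n)%N.
      by rewrite leqNgt; apply/negP => /lmin; rewrite ltnn.
    have [E|E] := q1S (N + l)%N; first by move: lt_n; rewrite E ltnNge le_n.
    have E' : (q (N + l)%N).1 = n by apply/eqP; rewrite eqn_leq le_n -ltnS -E.
    by rewrite E E'.
  (* Pigeonhole: the [N0.+1] pairs [(j, i)] have distinct codes, so one of the codes is at least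
     [N0]. *)
  have infpick N0 : exists2 n, (n >= N0)%N & sched n = j.
    have /existsNP : ~ forall i : 'I_N0.+1, (pickle (j, val i) < N0)%N.
      move=> h; pose f (i : 'I_N0.+1) : 'I_N0 := Ordinal (h i).
      have inj_f : injective f.
        move=> a b /(congr1 (@nat_of_ord _)) /= /(pcan_inj pickleK) [ab].
        by apply: val_inj.
      by have := leq_card f inj_f; rewrite !card_ord ltnn.
    move=> [i /negP]; rewrite -leqNgt => ?; exists (pickle (j, val i)) => //.
    by rewrite /sched pickleK.
  move=> N; have [n nN snj] := infpick (q N).1.
  have [k Nk [k1 k2]] := q1all _ _ nN; exists k => //.
  have [E|[m E]] := qS k; first by move: k2; rewrite E k1 => /eqP; rewrite -{1}[n]addn0 -addn1 eqn_add2l.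
  by exists m; rewrite E /= k1 snj eqxx.
- move=> k _ /=.
  (* The cover sees the tree [j] only once the counter has passed [j]; membership obtained at such a
     late [l] goes back to [k] because covers decrease along a branch. *)
  have [l kl jl] : exists2 l, (k <= l)%N & (j < (q l).1)%N.
    elim: j.+1 => [|n [l kl nl]]; first by exists k.
    have [l' ll' [m l'E]] := qinf l; exists l'.+1.
      by rewrite (leq_trans kl)// leqW.
    rewrite l'E /= ltnS (leq_trans nl)//.
    elim: l' ll' {l'E} => [|i IH]; first by rewrite leqn0 => /eqP ->.
    rewrite leq_eqVlt => /predU1P[-> //|/IH/leq_trans]; apply.
    by have [->|[? ->]] := qS i.
  have := Cx l I j jl.
  elim: l kl {jl} => [|i IH]; first by rewrite leqn0 => /eqP ->.
  rewrite leq_eqVlt => /predU1P[-> //|ki] cx; apply: IH => //.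
  have [E|[m E]] := qS i; first by rewrite -E.
  by move: cx; rewrite E /=; case: eqVneq => // _; exact: st_cover_next.
Qed.

(** The first move chooses a bound [M] and keeps the trees of index at most [M]; every later move is
    made in all of them simultaneously. Covers are then finite unions, and it is the finiteness of
    [M] that identifies their intersection along a branch: a point rejected by each tree at some
    stage is rejected by all of them at the largest stage. *)
Lemma souslin_bigcup (A : nat -> set T) :
  (forall j, souslin J (A j)) -> souslin J (\bigcup_j A j).
Proof.
move=> sA; have [t _] := chosen_tree sA; constructor.
pose P : Type := (option nat * (forall j, st_pos (t j)))%type.
pose nx (p : P) m : P := if p.1 is Some M then (Some M, fun j => st_next (p.2 j) m)
  else (Some m, p.2).
pose V (p : P) := if p.1 is Some M then \bigcup_(j < M.+1) st_val (p.2 j)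
  else \bigcup_j st_val (p.2 j).
pose C (p : P) := if p.1 is Some M then \bigcup_(j < M.+1) st_cover (p.2 j) else setT.
pose r : P := (None, fun j => st_root (t j)).
exists P r nx V C => //.
- by apply: eq_bigcupr => j _; rewrite st_val_root.
- move=> [[M|] p]; rewrite /V /=; apply/seteqP; split.
  + move=> x [j jM]; rewrite st_val_next => -[m _ xm]; exists m => //; exists j => //.
  + by move=> x [m _ [j jM xm]]; exists j => //; rewrite st_val_next; exists m.
  + by move=> x [j _ xj]; exists j => //; exists j => //=.
  + by move=> x [m _ [j jM xm]]; exists j.
- move=> [[M|] p] m n mn x; rewrite /V /nx /= => -[j jM xj]; exists j => //.
    exact: (st_val_next_mono mn).
  exact: leq_trans jM _.
- move=> [[M|] p] x; rewrite /V /C //= => -[j jM xj].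
  by exists j => //; exact: st_val_cover.
- move=> [[M|] p]; rewrite /C //=; elim: M.+1 => [|n IH].
    by rewrite bigcup_mkord big_ord0.
  rewrite (_ : \bigcup_(j < n.+1) _ = \bigcup_(j < n) st_cover (p j) `|` st_cover (p n)).
    exact: JU IH (st_coverJ _).
  apply/seteqP; split=> [x [j /=]|x [[j /= jn xj]|xn]].
  + by rewrite ltnS leq_eqVlt => /predU1P[->|jn] xj; [right|left; exists j].
  + by exists j => //=; exact: ltnW.
  + by exists n => /=.
- move=> [[M|] p] m x; rewrite /C //= => -[j jM xj].
  by exists j => //; exact: st_cover_next xj.
move=> q q0 qS qinf x Cx.
have [k0 kr [M kM]] : exists2 k0, q k0 = r & exists M, q k0.+1 = nx r M.
  have : exists k, (q k).1 != None.
    have [k _ [m E]] := qinf 0%N; exists k.+1.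
    by rewrite E /nx; case: (q k).1.
  move/ex_minnP => [[|k]]; first by rewrite q0.
  move=> kN kmin.
  have qr i : (i <= k)%N -> q i = r.
    elim: i => [//|i IH ik]; have [->|[m E]] := qS i; first by rewrite IH // ltnW.
    have : (q i.+1).1 = None.
      by apply/eqP; apply/negP => /negP /kmin; rewrite leqNgt ltnS ik.
    by rewrite E IH ?(ltnW ik).
  exists k; first exact: qr.
  have [E|[m E]] := qS k; first by move: kN; rewrite E qr.
  by exists m; rewrite E qr.
(* The branch may stutter at the root; [k0] is where [M] is chosen and [s] is what follows. *)
pose s k := q (k0.+1 + k)%N.
have sM k : (s k).1 = Some M.
  elim: k => [|k IH]; first by rewrite /s addn0 kM.
  rewrite /s addnS; have [->|[m ->]] := qS (k0.+1 + k)%N; first exact: IH.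
  by rewrite /nx -/(s k) IH.
have sS k m : q (k0.+1 + k).+1 = nx (q (k0.+1 + k)%N) m ->
    forall j, (s k.+1).2 j = st_next ((s k).2 j) m.
  by move=> E j; rewrite /s addnS E /nx -/(s k) sM.
apply: contrapT => nA.
have h j : exists k, (j < M.+1)%N -> ~ st_cover ((s k).2 j) x.
  have [jM|jM] := ltnP j M.+1; last by exists 0%N.
  apply: contrapT => /forallNP knot; apply: nA; exists j => //.
  apply: (@st_cover_branch _ _ (t j) (fun k => (s k).2 j)).
  - by rewrite /s addn0 kM.
  - move=> k; have [E|[m E]] := qS (k0.+1 + k)%N; first by left; rewrite /s addnS E.
    by right; exists m; exact: sS.
  - move=> n; have [k n_k [m E]] := qinf (k0.+1 + n)%N.
    have k0k : (k0.+1 <= k)%N by rewrite (leq_trans _ n_k)// leq_addr.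
    exists (k - k0.+1)%N; first by rewrite leq_subRL.
    by exists m; apply: sS; rewrite subnKC.
  - move=> k _; have := knot k; rewrite not_implyE => -[_ /contrapT]; exact.
have [f hf] := choice h.
pose K := (\max_(j < M.+1) f j)%N.
have := Cx (k0.+1 + K)%N I; rewrite /C -/(s K) sM => -[j /= jM]; have := hf j jM.
have : (f j <= K)%N by rewrite /K (@leq_bigmax _ (fun j : 'I_M.+1 => f j) (Ordinal jM)).
move: K => K fK nc c; apply: nc; elim: K fK c => [|k IH]; first by rewrite leqn0 => /eqP ->.
rewrite leq_eqVlt => /predU1P[-> //|fk] cx; apply: IH => //.
have [E|[m E]] := qS (k0.+1 + k)%N.
  by move: cx; rewrite {1}/s addnS E.
by move: cx; rewrite (sS _ _ E); exact: st_cover_next.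
Qed.

(** Souslin sets are not stable under complement, so the induction carries a set together with its
    complement. *)
Lemma souslin_sigma (C : set_system T) :
  (forall A, C A -> souslin J A /\ souslin J (~` A)) ->
  <<s C >> `<=` souslin J.
Proof.
move=> CJ; suff h : <<s C >> `<=` [set A | souslin J A /\ souslin J (~` A)].
  by move=> A /h[].
apply: smallest_sub => //; split => /=.
- by rewrite setC0; split; apply: souslin_base.
- by move=> A [? ?]; rewrite setTD setCK.
- move=> A mA; split; first by apply: souslin_bigcup => j; case: (mA j).
  by rewrite setC_bigcup; apply: souslin_bigcap => j; case: (mA j).
Qed.

End closure.

(** Choquet's argument: the value of a position is the increasing union of the values after its
    moves, so some move keeps [I] above [c]. The covers along the branch so chosen form the sequence
    [K]. The fixed set [E] allows the game to be played inside a bounded strip of time. *)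
Lemma souslin_capacity (R : realType) J A (I : set T -> \bar R) (c : \bar R) (E : set T) :
  souslin J A ->
  (forall X Y, X `<=` Y -> I X <= I Y) ->
  (forall X : nat -> set T, {homo X : m n / (m <= n)%N >-> m `<=` n} ->
     c < I (\bigcup_n X n) -> exists n, c < I (X n)) ->
  c < I (A `&` E) ->
  exists K : nat -> set T, [/\ forall n, J (K n),
    {homo K : m n / (m <= n)%N >-> n `<=` m}, \bigcap_n K n `<=` A &
    forall n, c < I (K n `&` E)].
Proof.
move=> [t] mI cI cA.
have h (p : st_pos t) : exists m, c < I (st_val p `&` E) -> c < I (st_val (st_next p m) `&` E).
  have [cp|] := pselect (c < I (st_val p `&` E)); last by exists 0%N.
  have := cp; rewrite st_val_next setI_bigcupl => /cI[|m cm].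
    by move=> i j ij; apply: setSI; exact: st_val_next_mono.
  by exists m.
have [f hf] := choice h.
pose q := fix q k := if k is k'.+1 then st_next (q k') (f (q k')) else st_root t.
exists (fun k => st_cover (q k)); split.
- by move=> n; exact: st_coverJ.
- move=> m n; elim: n => [|n IH]; first by rewrite leqn0 => /eqP ->.
  rewrite leq_eqVlt => /predU1P[->//|mn]; apply: subset_trans (IH mn).
  exact: st_cover_next.
- apply: st_cover_branch => //= [k|n]; first by right; exists (f (q k)).
  by exists n => //; exists (f (q n)).
- move=> n; apply: (@lt_le_trans _ _ (I (st_val (q n) `&` E))); last first.
    by apply: mI; apply: setSI; exact: st_val_cover.
  by elim: n => [|n IH] /=; [rewrite st_val_root|exact: hf].
Qed.

End souslin_trees.

(** * Closed rectangles *)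

Section sigma_algebra_closure.
Context {T : Type} (S : set_system T).
Hypothesis sS : sigma_algebra setT S.

Lemma sigma_algebra_setC A : S A -> S (~` A).
Proof. by case: sS => _ SC _ SA; rewrite -setTD; exact: SC. Qed.

Lemma sigma_algebra_setT : S setT.
Proof. by case: sS => S0 SC _; rewrite -(setD0 setT); exact: SC. Qed.

Lemma sigma_algebra_countU (I : countType) (A : I -> set T) :
  (forall i, S (A i)) -> S (\bigcup_i A i).
Proof.
case: sS => S0 _ SU SA.
rewrite (_ : \bigcup_i A i = \bigcup_n if unpickle n is Some i then A i else set0).
  by apply: SU => n; case: unpickle.
apply/seteqP; split=> [x [i _ Ax]|x [n _]]; first by exists (pickle i); rewrite ?pickleK.
by case: unpickle => // i Ax; exists i.
Qed.

Lemma sigma_algebra_countI (I : countType) (A : I -> set T) :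
  (forall i, S (A i)) -> S (\bigcap_i A i).
Proof.
move=> SA; rewrite -(setCK (\bigcap_i A i)) setC_bigcap.
by apply: sigma_algebra_setC; apply: sigma_algebra_countU => i; exact: sigma_algebra_setC.
Qed.

Lemma sigma_algebra_setU A B : S A -> S B -> S (A `|` B).
Proof.
move=> SA SB; rewrite (_ : A `|` B = \bigcup_(b : bool) if b then A else B).
  by apply: sigma_algebra_countU => -[].
apply/seteqP; split=> [x [Ax|Bx]|x [[] _ ?]]; by [exists true|exists false|left|right].
Qed.

Lemma sigma_algebra_setI A B : S A -> S B -> S (A `&` B).
Proof.
move=> SA SB; rewrite -(setCK (A `&` B)) setCI.
by apply: sigma_algebra_setC; apply: sigma_algebra_setU; exact: sigma_algebra_setC.
Qed.

Lemma sigma_algebra_setD A B : S A -> S B -> S (A `\` B).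
Proof.
by move=> SA SB; rewrite setDE; apply: sigma_algebra_setI => //; exact: sigma_algebra_setC.
Qed.

End sigma_algebra_closure.

Section rectangles.
Context {R : realType} {W : Type}.
Variable G : R -> set_system W.
Implicit Types (K L A : set (R * W)) (F : set W).

Definition at_time (T : W -> R) A : set W := [set w | A (T w, w)].

Definition shadow A : set W := [set w | exists t, A (t, w)].

Definition rect (a b : R) F : set (R * W) := [set z | (a <= z.1 <= b)%R /\ F z.2].

(* Asking for F in G (b + e), and not only in G b, makes the last exit times
   of the unions of these sets announced from the right. *)
Definition is_rect A := exists a b e F, [/\ (0 < e)%R, G (b + e)%R F & A = rect a b F].

Inductive rect_union : set (R * W) -> Prop :=
| rect_union0 : rect_union set0
| rect_unionS A K : is_rect A -> rect_union K -> rect_union (A `|` K).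

Definition rect_sigma : set_system (R * W) := <<s is_rect >>.

Lemma rect_sigma_algebra : sigma_algebra setT rect_sigma.
Proof. exact: smallest_sigma_algebra. Qed.

Lemma rect_union1 A : is_rect A -> rect_union A.
Proof. by move=> rA; rewrite -(setU0 A); exact: rect_unionS rect_union0. Qed.

Lemma rect_unionU : setU_closed rect_union.
Proof.
move=> K L; elim=> [|A {}K rA rK IH] rL; first by rewrite set0U.
by rewrite -setUA; apply: rect_unionS rA _; exact: IH.
Qed.

Hypothesis sG : forall t, sigma_algebra setT (G t).
Hypothesis Gd : forall t u, (t <= u)%R -> G u `<=` G t.

Lemma is_rectI A B : is_rect A -> is_rect B -> is_rect (A `&` B).
Proof.
move=> [a [b [e [F [e0 GF ->]]]]] [a' [b' [e' [F' [e'0 GF' ->]]]]].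
exists (Num.max a a'), (Num.min b b'), (Num.min e e'), (F `&` F').
split; first by rewrite lt_min e0.
- apply: (sigma_algebra_setI (sG _)); [apply: Gd GF|apply: Gd GF'];
    by apply: lerD; rewrite ge_min lexx ?orbT.
- apply/seteqP; split=> -[t w] /=; rewrite /rect /= ge_max le_min.
    by move=> [[/andP[-> ->] ?] [/andP[-> ->] ?]].
  by move=> [/andP[/andP[-> ->] /andP[-> ->]] [? ?]].
Qed.

Lemma rect_unionI : setI_closed rect_union.
Proof.
move=> K L; elim=> [|A {}K rA rK IH] rL; first by rewrite set0I; exact: rect_union0.
rewrite setIUl; apply: rect_unionU; last exact: IH.
elim: rL => [|B {IH}L rB rL IH]; first by rewrite setI0; exact: rect_union0.
by rewrite setIUr; apply: rect_unionS => //; exact: is_rectI.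
Qed.

Lemma rect_unionT (n : nat) : rect_union (rect (- n%:R) n%:R setT).
Proof.
apply: rect_union1; exists (- n%:R)%R, n%:R, 1%R, setT; split => //.
exact: (sigma_algebra_setT (sG _)).
Qed.

Lemma rect_union_exhaust : \bigcup_n (rect (- n%:R) n%:R setT : set (R * W)) = setT.
Proof.
rewrite -subTset => -[t w] _; exists (Num.trunc `|t|).+1 => //; split => //=.
by rewrite -ler_norml ltW// truncnS_gt.
Qed.

(** For one rectangle the event is [F] or empty, and it is [F] only if [t <= b], where [G (b + e)]
    is contained in [G (t + e)]. A finite union keeps the least of the margins, which is positive
    and does not depend on [t]. *)
Lemma rect_union_last_exit K : rect_union K ->
  exists2 e : R, (0 < e)%R & forall t, G (t + e)%R [set w | exists2 s, (t <= s)%R & K (s, w)].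
Proof.
elim=> [|A {}K [a [b [e [F [e0 GF ->]]]]] _ [e' e'0 IH]].
  exists 1%R => // t; rewrite (_ : [set _ | _] = set0); first by case: (sG (t + 1)).
  by rewrite -subset0 => w [].
exists (Num.min e e') => [|t]; first by rewrite lt_min e0.
rewrite (_ : [set _ | _] = [set w | (a <= b)%R /\ (t <= b)%R /\ F w] `|`
    [set w | exists2 s, (t <= s)%R & K (s, w)]).
  apply: (sigma_algebra_setU (sG _)); last first.
    by apply: Gd (IH t); rewrite lerD2l ge_min lexx orbT.
  have [ab|ba] := boolP (a <= b)%R; last first.
    by rewrite (_ : [set _ | _] = set0) -?subset0 => [|w []//]; case: (sG (t + Num.min e e')).
  have [tb|bt] := boolP (t <= b)%R; last first.
    by rewrite (_ : [set _ | _] = set0) -?subset0 => [|w [_ []]//]; case: (sG (t + Num.min e e')).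
  rewrite (_ : [set _ | _] = F); last by apply/seteqP; split=> [w [_ []]|].
  by apply: Gd GF; apply: lerD => //; rewrite ge_min lexx.
apply/seteqP; split=> [w [s ts [[/= /andP[as_ sb] Fw]|Kw]]|w [[ab [tb Fw]]|[s ts Ks]]].
- by left; split; [exact: le_trans sb|split => //; exact: le_trans sb].
- by right; exists s.
- by exists b => //; left; split=> //=; rewrite ab lexx.
- by exists s => //; right.
Qed.

Lemma rect_union_compact K w : rect_union K -> compact [set t | K (t, w)].
Proof.
elim=> [|A {}K [a [b [e [F [e0 GF ->]]]]] _ IH].
  by rewrite (_ : [set _ | _] = set0) //; exact: compact0.
rewrite (_ : [set _ | _] = [set t | rect a b F (t, w)] `|` [set t | K (t, w)]) //.
apply: compactU => //; have [Fw|nF] := pselect (F w).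
  rewrite (_ : [set _ | _] = `[a, b]%classic); first exact: segment_compact.
  by apply/seteqP; split=> t /=; rewrite /rect /= in_itv /=; [case|].
rewrite (_ : [set _ | _] = set0); first exact: compact0.
by rewrite -subset0 => t [].
Qed.

(** Points chosen in the successive sections have a cluster point in the compact section of [K 0],
    and it lies in all the closed sections. Projection to [W] thus commutes with these decreasing
    intersections. *)
Lemma rect_union_bigcap (K : nat -> set (R * W)) (w : W) (t : R) :
  (forall n, rect_union (K n)) ->
  {homo K : m n / (m <= n)%N >-> n `<=` m} ->
  (forall n, exists2 s, (t <= s)%R & K n (s, w)) ->
  exists2 s, (t <= s)%R & forall n, K n (s, w).
Proof.
move=> rK Kd h; have [f tf Kf] : exists2 f : nat -> R, (forall n, t <= f n)%R & forall n, K n (f n, w).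
  have [f hf] := choice (fun n => let: ex_intro2 s a b := h n in ex_intro
    (fun s => (t <= s)%R /\ K n (s, w)) s (conj a b)).
  by exists f => n; case: (hf n).
have K0f : (f n @[n --> \oo]) [set s | K 0%N (s, w)].
  by exists 0%N => // n _ /=; exact: (Kd 0%N n) (Kf n).
have [s [K0s cs]] := rect_union_compact (w := w) (rK 0%N) (fmap_proper_filter _ _) K0f.
have cl (C : set R) : closed C -> (\forall n \near \oo, C (f n)) -> C s.
  by move=> cC FC; apply: cC => B sB; exact: cs FC sB.
exists s.
  by apply: (cl [set u | t <= u]%R); [exact: closed_ge|near=> n; exact: tf].
move=> n; apply: (cl [set u | K n (u, w)]).
  by apply: compact_closed; [exact: norm_hausdorff|exact: rect_union_compact].
by exists n => // m /= nm; exact: (Kd n m) (Kf m).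
Unshelve. all: by end_near. Qed.

(** The class of covers must contain [setT], which is no finite union of bounded rectangles; hence
    sets that become finite unions after intersection with any finite union. *)
Lemma rect_sigma_souslin :
  rect_sigma `<=` souslin [set K | forall L, rect_union L -> rect_union (K `&` L)].
Proof.
apply: souslin_sigma => /=.
- by move=> L; rewrite setTI.
- by move=> A B rA rB L rL; rewrite -setIA; apply: rA; exact: rB.
- by move=> A B rA rB L rL; rewrite setIUl; apply: rect_unionU; [exact: rA|exact: rB].
- by move=> L _; rewrite set0I; exact: rect_union0.
set J := [set K | _].
have J0 : J set0 by move=> L _; rewrite set0I; exact: rect_union0.
have JT : J setT by move=> L; rewrite setTI.
have JI : setI_closed J by move=> A B rA rB L rL; rewrite -setIA; apply: rA; exact: rB.
have JU : setU_closed J.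
  by move=> A B rA rB L rL; rewrite setIUl; apply: rect_unionU; [exact: rA|exact: rB].
have Jr A : is_rect A -> J A by move=> rA L; apply: rect_unionI; exact: rect_union1.
move=> A rA; split; first by apply: souslin_base; exact: Jr.
case: rA => a [b [e [F [e0 GF ->]]]].
(* A point leaves the rectangle through its time or through [F]. The two open half-lines of time are
   exhausted by compact intervals. *)
rewrite (_ : ~` _ = \bigcup_n (rect (- n%:R) (a - n.+1%:R^-1) setT `|`
   rect (b + n.+1%:R^-1) n%:R setT `|` rect a b (~` F))).
  apply: souslin_bigcup => // n; apply: souslin_base; apply: (JU); first apply: (JU).
  - apply: Jr; eexists; eexists; exists 1%R, setT; split; [by []| |by []].
    exact: (sigma_algebra_setT (sG _)).
  - apply: Jr; eexists; eexists; exists 1%R, setT; split; [by []| |by []].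
    exact: (sigma_algebra_setT (sG _)).
  - apply: Jr; eexists; eexists; exists e, (~` F); split; [by []| |by []].
    exact: (sigma_algebra_setC (sG _)).
have small (x : R) : (0 < x)%R -> exists N, forall n, (N <= n)%N -> (n.+1%:R^-1 <= x)%R.
  move=> x0; exists (Num.trunc x^-1) => n Nn; rewrite -[leRHS]invrK lef_pV2 ?posrE ?invr_gt0//.
  by rewrite ltW// (lt_le_trans (truncnS_gt _))// ler_nat.
have big (x : R) : exists N, forall n, (N <= n)%N -> (`|x| <= n%:R)%R.
  exists (Num.trunc `|x|).+1 => n Nn.
  by rewrite ltW// (lt_le_trans (truncnS_gt _))// ler_nat.
apply/seteqP; split=> [[t w] nA|[t w] [n _ [[[/= /andP[_ ta] _]|[/= /andP[bt _] _]]|[_ nF]]] [/= /andP[at_ tb] Fw]].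
- have [M bigM] := big t.
  have [ta|at_] := ltP t a.
    have [N sN] := small (a - t)%R ltac:(by rewrite subr_gt0).
    exists (maxn M N) => //; left; left; split => //=.
    have := bigM _ (leq_maxl M N); rewrite ler_norml => /andP[-> _] /=.
    by rewrite lerBrDl -lerBrDr sN// leq_maxr.
  have [bt|tb] := ltP b t.
    have [N sN] := small (t - b)%R ltac:(by rewrite subr_gt0).
    exists (maxn M N) => //; left; right; split => //=.
    have := bigM _ (leq_maxl M N); rewrite ler_norml => /andP[_ ->] /=.
    by rewrite andbT -lerBrDl sN// leq_maxr.
  exists 0%N => //; right; split=> /=; first by rewrite at_.
  by move=> Fw; apply: nA; split=> //=; rewrite at_.
- have : (a <= a - n.+1%:R^-1)%R by exact: le_trans ta.
  by rewrite lerBrDl gerDr leNgt invr_gt0 ltr0n.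
- have : (b + n.+1%:R^-1 <= b)%R by exact: le_trans tb.
  by rewrite gerDl leNgt invr_gt0 ltr0n.
- exact: nF.
Qed.

End rectangles.

(** * The outer measure of the projection to W as a capacity *)

Section shadow_capacity.
Context {R : realType} d {W : measurableType d}.
Variable mu : {measure set W -> \bar R}.
Hypothesis mu_fin : mu setT < +oo.
Variable G : R -> set_system W.
Hypothesis sG : forall t, sigma_algebra setT (G t).
Hypothesis Gd : forall t u, (t <= u)%R -> G u `<=` G t.
Hypothesis Gm : forall t, G t `<=` measurable.
Implicit Types (A K : set (R * W)).

Definition shadow_capacity A : \bar R :=
  ereal_inf [set mu B | B in [set B | measurable B /\ shadow A `<=` B]].

Lemma le_shadow_capacity A B : A `<=` B -> shadow_capacity A <= shadow_capacity B.
Proof.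
move=> AB; apply: ereal_inf_le_tmp => _ [C [mC BC] <-]; exists C => //; split => //.
by apply: subset_trans BC => w [t At]; exists t; exact: AB.
Qed.

Lemma shadow_capacity_le A B : measurable B -> shadow A `<=` B -> shadow_capacity A <= mu B.
Proof. by move=> mB AB; apply: ereal_inf_lbound; exists B. Qed.

Lemma shadow_capacity_lt A c : shadow_capacity A < c ->
  exists B, [/\ measurable B, shadow A `<=` B & mu B < c].
Proof. by move/ereal_inf_lt => -[_ [B [mB AB] <-]]; exists B. Qed.

Lemma finite_mu B : measurable B -> mu B < +oo.
Proof. by move=> mB; apply: le_lt_trans mu_fin; apply: le_measure; rewrite ?inE. Qed.

Lemma shadow_capacity0 A : shadow_capacity A = 0 ->
  exists B, [/\ measurable B, shadow A `<=` B & mu B = 0].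
Proof.
move=> A0; have h (n : nat) : exists B, [/\ measurable B, shadow A `<=` B & mu B < n.+1%:R^-1%:E].
  by apply: shadow_capacity_lt; rewrite A0 lte_fin invr_gt0 ltr0n.
have [B hB] := choice h; exists (\bigcap_n B n); split.
- by apply: bigcapT_measurable => n; case: (hB n).
- by move=> w Aw n _; case: (hB n) => _ + _; apply.
apply/eqP; rewrite eq_le measure_ge0 andbT; apply/lee_addgt0Pr => e e0; rewrite add0e.
have [n ne] : exists n, (n.+1%:R^-1 <= e)%R.
  exists (Num.trunc e^-1); rewrite -[leRHS]invrK lef_pV2 ?posrE ?invr_gt0//.
  exact/ltW/truncnS_gt.
apply: (@le_trans _ _ (mu (B n))); last first.
  by case: (hB n) => _ _ /ltW/le_trans; apply; rewrite lee_fin.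
apply: le_measure; rewrite ?inE; last exact: bigcap_inf.
- by apply: bigcapT_measurable => i; case: (hB i).
- by case: (hB n).
Qed.

(** Nearly optimal covers [B n] of the projections need not increase. The tails [C n], the
    intersections of the [B k] for [k >= n], do, and they still cover because [X] increases;
    measures are then continuous from below along them. *)
Lemma shadow_capacity_bigcup (X : nat -> set (R * W)) c :
  {homo X : m n / (m <= n)%N >-> m `<=` n} ->
  c < shadow_capacity (\bigcup_n X n) -> exists n, c < shadow_capacity (X n).
Proof.
move=> Xn; apply: contraPP => /forallNP Xc; apply/negP; rewrite -leNgt.
have {}Xc n : shadow_capacity (X n) <= c by rewrite leNgt; apply/negP.
apply/lee_addgt0Pr => e e0.
have [->|cy] := eqVneq c +oo; first by rewrite leey.
have c0 : 0 <= c.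
  by apply: le_trans (Xc 0%N); apply: le_ereal_inf_tmp => _ [B _ <-].
have cfin : c \is a fin_num by rewrite ge0_fin_numE// ltey.
have h n : exists B, [/\ measurable B, shadow (X n) `<=` B & mu B < c + e%:E].
  apply: shadow_capacity_lt; apply: le_lt_trans (Xc n) _.
  by rewrite lteDl// lte_fin.
have [B hB] := choice h.
pose C n := \bigcap_k B (n + k)%N.
have mC n : measurable (C n).
  by apply: bigcapT_measurable => k; case: (hB (n + k)%N).
have ndC : nondecreasing_seq C.
  move=> m n mn; apply/subsetPset => w Cw k _.
  by have := Cw (n - m + k)%N I; rewrite addnA subnKC.
have mUC : measurable (\bigcup_n C n) by exact: bigcupT_measurable.
apply: (@le_trans _ _ (mu (\bigcup_n C n))).
  apply: shadow_capacity_le => // w [t [n _ Xt]]; exists n => // k _.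
  case: (hB (n + k)%N) => _ + _; apply; exists t.
  by apply: Xn Xt; exact: leq_addr.
apply: (cvge_to_le (nondecreasing_cvg_mu (mu := mu) mC mUC ndC)).
near=> n; apply: (@le_trans _ _ (mu (B n))).
  apply: le_measure; rewrite ?inE//; first by case: (hB n).
  by move=> w /(_ 0%N I); rewrite addn0.
by case: (hB n) => _ _ /ltW.
Unshelve. all: by end_near. Qed.

Lemma measurable_last_exit K t : rect_union G K ->
  measurable [set w | exists2 s, (t <= s)%R & K (s, w)].
Proof. by move=> /(rect_union_last_exit sG Gd) [e e0 /(_ t)]; exact: Gm. Qed.

Lemma measurable_shadow K : rect_union G K -> measurable (shadow K).
Proof.
move=> rK; rewrite (_ : shadow K = \bigcup_(n : nat) [set w | exists2 s, (- n%:R <= s)%R & K (s, w)]).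
  by apply: bigcupT_measurable => n; exact: measurable_last_exit.
apply/seteqP; split=> [w [t Kt]|w [n _ [s _ Ks]]]; last by exists s.
exists (Num.trunc `|t|).+1 => //; exists t => //.
by rewrite lerNl ltW// (le_lt_trans (ler_norm _))// normrN truncnS_gt.
Qed.

Lemma rect_sigma_section A c : rect_sigma G A -> c < shadow_capacity A ->
  exists K : nat -> set (R * W), [/\ forall n, rect_union G (K n),
    {homo K : m n / (m <= n)%N >-> n `<=` m}, \bigcap_n K n `<=` A,
    shadow (\bigcap_n K n) = \bigcap_n shadow (K n) &
    forall n, c < mu (shadow (K n))].
Proof.
move=> /(rect_sigma_souslin sG Gd) sA cA.
(* Cutting time to [[-m, m]] costs no capacity in the limit, turns the covers into finite unions of
   rectangles, and supplies the lower time bound needed for the compactness argument. *)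
have [m cm] : exists m, c < shadow_capacity (A `&` rect (- m%:R) m%:R setT).
  apply: shadow_capacity_bigcup.
    move=> m n mn; apply: setIS => -[t w] [/= /andP[mt tm] _]; split => //=.
    by rewrite (le_trans _ mt) ?(le_trans tm)// ?lerN2 ler_nat.
  by rewrite -setI_bigcupr rect_union_exhaust setIT.
have [K [JK Kd KA cK]] := souslin_capacity sA le_shadow_capacity
  (@shadow_capacity_bigcup^~ c) cm.
pose L n := K n `&` rect (- m%:R) m%:R setT.
have rL n : rect_union G (L n) by apply: JK; exact: rect_unionT.
have Ld : {homo L : m n / (m <= n)%N >-> n `<=` m}.
  by move=> i j ij; apply: setSI; exact: Kd.
exists L; split => //.
- by apply: subset_trans KA => z Lz n _; case: (Lz n I).
- apply/seteqP; split=> [w [t Lt] n _|w sw]; first by exists t; exact: Lt.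
  have [n|s _ Ls] := rect_union_bigcap (t := (- m%:R)%R) (w := w) rL Ld.
    by have [t Lt] := sw n I; exists t => //; case: Lt => _ [/= /andP[]].
  by exists s => n _; exact: Ls.
- move=> n; apply: lt_le_trans (cK n) _; apply: shadow_capacity_le => //.
  exact: measurable_shadow.
Qed.

Lemma rect_sigma_section_measure A c : rect_sigma G A -> c < shadow_capacity A ->
  exists K : nat -> set (R * W), [/\ forall n, rect_union G (K n),
    {homo K : m n / (m <= n)%N >-> n `<=` m}, \bigcap_n K n `<=` A &
    [/\ measurable (shadow (\bigcap_n K n)),
    (forall F, measurable F -> mu (F `&` shadow (K n)) @[n --> \oo] -->
                               mu (F `&` shadow (\bigcap_n K n))) &
    c <= mu (shadow (\bigcap_n K n))]].
Proof.
move=> sA cA; have [K [rK Kd KA sK cK]] := rect_sigma_section sA cA.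
have mN : measurable (shadow (\bigcap_n K n)).
  by rewrite sK; apply: bigcapT_measurable => n; exact: measurable_shadow.
have cv F : measurable F -> mu (F `&` shadow (K n)) @[n --> \oo] -->
                            mu (F `&` shadow (\bigcap_n K n)).
  move=> mF; have mFK n : measurable (F `&` shadow (K n)).
    by apply: measurableI => //; exact: measurable_shadow.
  rewrite sK -bigcapIr; last by exists 0%N.
  apply: (nonincreasing_cvg_mu (F := fun n => F `&` shadow (K n))) => //.
  - exact: finite_mu.
  - exact: bigcapT_measurable.
  - move=> m n mn; apply/subsetPset => w [Fw [t Kt]]; split => //.
    by exists t; exact: Kd Kt.
exists K; split => //; split => //.
have := cv setT measurableT; rewrite setTI => /cvge_to_ge; apply.
by near=> n; rewrite setTI; exact/ltW.
Unshelve. all: by end_near. Qed.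

End shadow_capacity.

(** * Events recurring at rational times just after t *)

Section right_accumulation.
Context {R : realType} d {W : measurableType d}.
Variable mu : {measure set W -> \bar R}.
Hypothesis mu_fin : mu setT < +oo.
Variable G : R -> set_system W.
Hypothesis sG : forall t, sigma_algebra setT (G t).
Hypothesis Gd : forall t u, (t <= u)%R -> G u `<=` G t.
Hypothesis Gm : forall t, G t `<=` measurable.

Definition right_accumulation (B : rat -> set W) : set (R * W) :=
  [set z | forall e : R, (0 < e)%R -> exists u : rat, (z.1 < ratr u < z.1 + e)%R /\ B u z.2].

(** The strict inequality [t < u] is essential: a rectangle that carries [B u] stops at a distance
    [1 / (k + 1)] before [u], and this distance is its margin. *)
Lemma right_accumulation_sigma B : (forall u, G (ratr u) (B u)) ->
  rect_sigma G (right_accumulation B).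
Proof.
move=> GB; have sR := rect_sigma_algebra G.
rewrite (_ : right_accumulation B = \bigcap_(n : nat) \bigcup_(u : rat) \bigcup_(k : nat)
    rect (ratr u - n.+1%:R^-1 + k.+1%:R^-1) (ratr u - k.+1%:R^-1) (B u)).
  apply: (sigma_algebra_countI sR) => n; apply: (sigma_algebra_countU sR) => u.
  apply: (sigma_algebra_countU sR) => k; apply: sub_sigma_algebra.
  exists (ratr u - n.+1%:R^-1 + k.+1%:R^-1)%R, (ratr u - k.+1%:R^-1)%R, (k.+1%:R^-1)%R, (B u).
  by split; [rewrite invr_gt0 ltr0n|rewrite subrK|reflexivity].
have inv_small (x : R) : (0 < x)%R -> exists n : nat, (n.+1%:R^-1 <= x)%R.
  move=> x0; exists (Num.trunc x^-1); rewrite -[leRHS]invrK lef_pV2 ?posrE ?invr_gt0//.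
  exact/ltW/truncnS_gt.
apply/seteqP; split=> -[t w] /= h.
  move=> n _; have [u [/andP[tu ut] Bu]] := h (n.+1%:R^-1)%R ltac:(by rewrite invr_gt0 ltr0n).
  exists u => //.
  have [k ks] := inv_small (Num.min (ratr u - t) (t + n.+1%:R^-1 - ratr u))%R
    ltac:(by rewrite lt_min !subr_gt0 tu).
  move: ks; rewrite le_min => /andP[k1 k2].
  exists k => //; split=> //=; apply/andP; split; last by rewrite lerBrDr -lerBrDl.
  by rewrite addrAC lerBlDr -lerBrDl.
move=> e e0; have [n ne] := inv_small _ e0.
have [u _ [k _ [/= /andP[k1 k2] Bu]]] := h n I; exists u; split => //.
have k0 : (0 < k.+1%:R^-1 :> R)%R by rewrite invr_gt0 ltr0n.
move: k1 k2 k0 ne e0; move: (k.+1%:R^-1)%R (n.+1%:R^-1)%R (ratr u) => i j r k1 k2 k0 ne e0.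
by apply/andP; split; lra.
Qed.

Variables (F : set W) (b : R) (B : rat -> set W).
Hypotheses (mF : measurable F) (b0 : (0 <= b)%R) (GB : forall u, G (ratr u) (B u)).
Hypothesis hB : forall u H, G (ratr u) H -> H `<=` B u -> b%:E * mu H <= mu (F `&` H).

Let le_finite_bigcup (C : rat -> set W) (s : seq rat) :
  (forall u, G (ratr u) (C u)) -> (forall u, C u `<=` B u) -> sorted <=%R s ->
  measurable [set w | exists2 u, u \in s & C u w] /\
  b%:E * mu [set w | exists2 u, u \in s & C u w] <=
  mu (F `&` [set w | exists2 u, u \in s & C u w]).
Proof.
move=> GC CB; elim: s => [_|u s IH us].
  by rewrite (_ : [set _ | _] = set0) -?subset0 => [|w []//]; rewrite setI0 measure0 mule0.
have [mV bV] := IH (path_sorted us).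
(* [G] decreases, so what was found at the later times of [s] is already known at the earlier time
   [u]; the new part [C u] minus [V] is then in [G (ratr u)] and [hB] applies to it. *)
have GV : G (ratr u) [set w | exists2 v, v \in s & C v w].
  rewrite (_ : [set _ | _] = \bigcup_(v : rat) if v \in s then C v else set0).
    apply: (sigma_algebra_countU (sG _)) => v; case: ifPn => [vs|_]; last by case: (sG (ratr u)).
    apply: Gd (GC v); rewrite ler_rat.
    by have /allP := order_path_min le_trans us; apply.
  apply/seteqP; split=> [w [v vs Cv]|w [v _]]; first by exists v; rewrite ?vs.
  by case: ifPn => // vs Cv; exists v.
set V := [set w | exists2 v, v \in s & C v w] in mV bV GV *.
have -> : [set w | exists2 v, v \in u :: s & C v w] = V `|` (C u `\` V).
  apply/seteqP; split=> [w [v]|w [[v vs Cv]|[Cu _]]].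
  - rewrite inE => /predU1P[-> Cu|vs Cv]; last by left; exists v.
    by have [Vw|nV] := pselect (V w); [left|right].
  - by exists v; rewrite // inE vs orbT.
  - by exists u; rewrite // mem_head.
have GD : G (ratr u) (C u `\` V) by exact: (sigma_algebra_setD (sG _) (GC u) GV).
have mD := Gm GD; split; first exact: measurableU.
have dis : V `&` (C u `\` V) = set0.
  by rewrite -subset0 => w [Vw []].
rewrite measureU// setIUr measureU; last 3 first.
- exact: measurableI.
- exact: measurableI.
- by rewrite setIACA setIid dis setI0.
rewrite muleDr//; last by rewrite ge0_adde_def// inE.
by apply: leeD => //; apply: (hB GD) => w [/CB].
Qed.

Let le_bigcup (C : rat -> set W) :
  (forall u, G (ratr u) (C u)) -> (forall u, C u `<=` B u) ->
  b%:E * mu (\bigcup_u C u) <= mu (F `&` \bigcup_u C u).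
Proof.
move=> GC CB.
pose s n := sort <=%R (pmap (@pickle_inv rat) (iota 0 n) : seq rat).
pose V n := [set w | exists2 u, u \in s n & C u w].
have hV n := le_finite_bigcup GC CB (sort_sorted (@le_total _ rat) (pmap (@pickle_inv rat) (iota 0 n))).
have sE n u : (u \in s n) = (pickle u < n)%N.
  rewrite mem_sort mem_pmap; apply/mapP/idP => [[k]|un].
    by rewrite mem_iota /= add0n => kn uk; have := @pickle_invK rat k; rewrite -uk /= => ->.
  by exists (pickle u); rewrite ?pickleK_inv// mem_iota.
have UV : \bigcup_u C u = \bigcup_n V n.
  apply/seteqP; split=> [w [u _ Cu]|w [n _ [u _ Cu]]]; last by exists u.
  by exists (pickle u).+1 => //; exists u; rewrite ?sE.
have mV n : measurable (V n) by case: (hV n).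
have mUV : measurable (\bigcup_n V n) by exact: bigcupT_measurable.
have ndV : nondecreasing_seq V.
  move=> m n mn; apply/subsetPset => w [u um Cu]; exists u => //.
  by rewrite sE (leq_trans _ mn)// -sE.
rewrite UV; have cv := nondecreasing_cvg_mu (mu := mu) mV mUV ndV.
apply: (cvge_to_le (cvgeZl (y := b%:E) isT cv)); near=> n.
apply: le_trans (hV n).2 _; apply: le_measure; rewrite ?inE; [exact: measurableI mF (mV n)|exact: measurableI|].
by apply: setIS => w Vw; exists n.
Unshelve. all: by end_near. Qed.

Lemma right_accumulation_lower_bound A c : rect_sigma G A ->
  A `<=` right_accumulation B -> c < shadow_capacity mu A ->
  exists N, [/\ measurable N, N `<=` shadow A, c <= mu N & b%:E * mu N <= mu (F `&` N)].
Proof.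
move=> sA AB /(rect_sigma_section_measure mu_fin sG Gd Gm sA).
move=> [K [rK Kd KA [mN cvN cN]]]; exists (shadow (\bigcap_n K n)); split => //.
  by move=> w [t Kt]; exists t; exact: KA.
set N := shadow _ in mN cvN cN *.
have mS n : measurable (shadow (K n)) by exact: (measurable_shadow sG Gd Gm).
apply: (cvge_to_ge (cvN F mF)); near=> n.
have [e e0 Ge] := rect_union_last_exit sG Gd (rK n).
(* [e] is the margin of [K n], which makes the last exit condition at [ratr u - e] an event of
   [G (ratr u)]. The union of the [C u] contains [N], since some [u] in []t, t + e[] has [w] in
   [B u], and is contained in the projection of [K n]; letting [n] grow closes the gap. *)
pose C u := B u `&` [set w | exists2 s, (ratr u - e <= s)%R & K n (s, w)].
have GC u : G (ratr u) (C u).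
  apply: (sigma_algebra_setI (sG _)) => //.
  by have := Ge (ratr u - e)%R; rewrite subrK.
have CB u : C u `<=` B u by move=> w [].
have mC : measurable (\bigcup_u C u).
  by apply: bigcupT_measurable_rat => u; exact: Gm (GC u).
apply: (@le_trans _ _ (b%:E * mu (\bigcup_u C u))).
  apply: lee_wpmul2l => //; apply: le_measure; rewrite ?inE//.
  move=> w [t Kt]; have [u [/andP[tu ut] Bu]] := AB _ (KA _ Kt) e e0.
  exists u => //; split => //; exists t; last exact: Kt.
  by rewrite lerBlDr ltW.
apply: le_trans (le_bigcup GC CB) _; apply: le_measure; rewrite ?inE; try exact: measurableI.
by apply: setIS => w [u _ [_ [s _ Ks]]]; exists s.
Unshelve. all: by end_near. Qed.

End right_accumulation.

(** * Hahn decomposition on a sub-sigma-algebra *)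

Section sub_measure.
Context {R : realType} d {W : measurableType d}.
Variable mu : {measure set W -> \bar R}.
Hypothesis mu_fin : mu setT < +oo.
Variable S : set_system W.
Hypothesis sS : sigma_algebra setT S.
Hypothesis Sm : S `<=` measurable.

(** The hypotheses are arguments of the definition so that the finite measure structure declared
    below can recover them from the term. *)
Definition sub_measure (_ : mu setT < +oo) (_ : sigma_algebra setT S) (_ : S `<=` measurable)
  : set (g_sigma_algebraType S) -> \bar R := mu.

Let nu := sub_measure mu_fin sS Sm.

Let measurable_sub (A : set (g_sigma_algebraType S)) :
  measurable A -> measurable (A : set W).
Proof. by rewrite /measurable /= sigma_algebra_id// => /Sm. Qed.

Let nu0 : nu set0 = 0. Proof. exact: measure0. Qed.
Let nu_ge0 A : 0 <= nu A. Proof. exact: measure_ge0. Qed.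
Let nu_sigma : semi_sigma_additive nu.
Proof.
move=> F mF tF mUF; apply: measure_semi_sigma_additive => //.
- by move=> i; exact: measurable_sub.
- exact: measurable_sub mUF.
Qed.
HB.instance Definition _ := isMeasure.Build _ _ _ nu nu0 nu_ge0 nu_sigma.

Let nu_fin : fin_num_fun nu.
Proof.
move=> A mA; rewrite ge0_fin_numE//; apply: le_lt_trans mu_fin.
by apply: le_measure; rewrite ?inE//; exact: measurable_sub.
Qed.
HB.instance Definition _ := @Measure_isFinite.Build _ _ _ nu nu_fin.

End sub_measure.

Section hahn_level.
Context {R : realType} d {W : measurableType d}.
Variable mu : {measure set W -> \bar R}.
Hypothesis mu_fin : mu setT < +oo.
Variable S : set_system W.
Hypothesis sS : sigma_algebra setT S.
Hypothesis Sm : S `<=` measurable.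

(** [P] stands for the event that the conditional probability of [F] given [S] is at least [r], up
    to normalization of [mu]; no conditional expectation has to be constructed. *)
Lemma hahn_level (F : set W) (r : R) : measurable F -> exists P, [/\ S P,
  forall H, S H -> H `<=` P -> r%:E * mu H <= mu (F `&` H) &
  forall H, S H -> H `<=` ~` P -> mu (F `&` H) <= r%:E * mu H].
Proof.
move=> mF.
have muF_fin : mrestr mu mF setT < +oo.
  by apply: (finite_mu mu_fin); exact: measurableI.
pose m1 : {finite_measure set (g_sigma_algebraType S) -> \bar R} := sub_measure muF_fin sS Sm.
pose m2 : {finite_measure set (g_sigma_algebraType S) -> \bar R} := sub_measure mu_fin sS Sm.
have [P [N [[mP posP] [_ negN] PN dis]]] := Hahn_decomposition
  (cadd (charge_of_finite_measure m1) (cscale (- r) (charge_of_finite_measure m2))).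
have SE (A : set (g_sigma_algebraType S)) : S A -> measurable A by exact: sub_sigma_algebra.
have fin (H : set W) : S H -> mu H \is a fin_num.
  by move=> /Sm mH; rewrite ge0_fin_numE//; exact: (finite_mu mu_fin).
exists P; split.
- by move: mP; rewrite /measurable /= sigma_algebra_id.
- move=> H SH HP; have : 0 <= mu (H `&` F) + (- r)%:E * mu H := posP H (SE _ SH) HP.
  by rewrite EFinN mulNe suber_ge0 ?fin_numM ?fin// (setIC H).
- move=> H SH HP.
  have HN : H `<=` N by move=> w Hw; have := HP _ Hw; have : setT w by []; rewrite -PN => -[].
  have : mu (H `&` F) + (- r)%:E * mu H <= 0 := negN H (SE _ SH) HN.
  by rewrite EFinN mulNe sube_le0 (setIC H).
Qed.

End hahn_level.

(** * Projection of a measurable set *)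

Section layers.
Context {R : realType} d {W : measurableType d}.
Variables (mu nu : {measure set W -> \bar R}) (C : set W) (g : W -> \bar R).
Hypotheses (mC : measurable C) (muC : mu C < +oo) (mg : measurable_fun setT g).
Hypotheses (g0 : forall w, 0 <= g w) (gfin : forall w, g w < +oo).

Let layer (a b : rat) := C `&` [set w | (ratr a)%:E <= g w < (ratr b)%:E].

(** The two bounds are not symmetric: a supremum that is at least [b] has a member exceeding [a]
    only for [a < b], so the lower bound is available only strictly below the layer. *)
Hypothesis lower : forall a b c : rat, (0 <= a < b)%R ->
  (ratr a)%:E * mu (layer b c) <= nu (layer b c).
Hypothesis upper : forall b c : rat, (0 <= c)%R ->
  nu (layer b c) <= (ratr c)%:E * mu (layer b c).

Let measurable_layer a b : measurable (layer a b).
Proof.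
rewrite /layer (_ : [set w | _] = (g @^-1` `[(ratr a)%:E, (ratr b)%:E[)).
  apply: measurableI => //; rewrite -[X in measurable X]setTI.
  by apply: mg => //; exact: emeasurable_itv.
by apply/seteqP; split=> w /=; rewrite in_itv /=.
Qed.

Section mesh.
Variable e : rat.
Hypothesis e0 : (0 < e)%R.

Let X (k : nat) := layer (k%:R * e) (k.+1%:R * e).

Let re0 : (0 < ratr e :> R)%R. Proof. by rewrite ltr0q. Qed.

Let ratrX (k : nat) : ratr (k%:R * e) = (k%:R * ratr e)%R :> R.
Proof. by rewrite rmorphM /= ratr_nat. Qed.

Let coverX : \bigcup_k X k = C.
Proof.
apply/seteqP; split=> [w [k _ []//]|w Cw].
have := g0 w; have := gfin w; case gE : (g w) => [r| |]//= _; rewrite lee_fin => r0.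
have /trunc_itv/andP[k1 k2] : (0 <= r / ratr e)%R by rewrite divr_ge0// ltW.
exists (Num.trunc (r / ratr e)) => //; split => //=.
rewrite gE lee_fin lte_fin !ratrX -ler_pdivlMr// k1 /=.
by rewrite -ltr_pdivrMr.
Qed.

Let trivX : trivIset setT X.
Proof.
have H k l : (k < l)%N -> X k `&` X l = set0.
  move=> kl; rewrite -subset0 => w [[_ /= /andP[_ gk]] [_ /= /andP[gl _]]].
  have := le_lt_trans gl gk; rewrite lte_fin !ratrX ltr_pM2r// ltr_nat ltnS.
  by rewrite leqNgt kl.
apply/trivIsetP => k l _ _; rewrite neq_lt => /orP[] kl; first exact: H.
by rewrite setIC; exact: H.
Qed.

Let measureX (la : {measure set W -> \bar R}) : la C = \sum_(k <oo) la (X k).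
Proof.
rewrite -{1}coverX measure_bigcup//; last by move=> *; exact: measurable_layer.
by apply: eq_eseriesl => k; rewrite in_setT.
Qed.

Let integralX : \int[mu]_(w in C) g w = \sum_(k <oo) \int[mu]_(w in X k) g w.
Proof.
rewrite -{1}coverX ge0_integral_bigcup//; first by move=> k; exact: measurable_layer.
by rewrite coverX; exact: measurable_funTS.
Qed.

Let le_integral_layer k : \int[mu]_(w in X k) g w <= (ratr (k.+1%:R * e))%:E * mu (X k).
Proof.
have mX : measurable (X k) by exact: measurable_layer.
rewrite -integral_cst//; apply: ge0_le_integral => //.
- exact: measurable_funTS.
- by move=> w [_ /andP[_ /ltW]].
Qed.

Let ge_integral_layer k : (ratr (k%:R * e))%:E * mu (X k) <= \int[mu]_(w in X k) g w.
Proof.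
have mX : measurable (X k) by exact: measurable_layer.
rewrite -integral_cst//; apply: ge0_le_integral => //.
- by move=> w _ /=; rewrite lee_fin ratrX mulr_ge0// ltW.
- exact: measurable_funTS.
- by move=> w [_ /andP[]].
Qed.

Let layer_step k (x : R) : (ratr (k%:R * e) + x)%:E * mu (X k) =
  (ratr (k%:R * e))%:E * mu (X k) + x%:E * mu (X k).
Proof.
have fX : mu (X k) \is a fin_num.
  rewrite ge0_fin_numE//; apply: le_lt_trans muC.
  by apply: le_measure; rewrite ?inE//; [exact: measurable_layer|move=> w []].
by rewrite -(fineK fX) -!EFinM -EFinD mulrDl.
Qed.

Lemma layers_le : nu C <= \int[mu]_(w in C) g w + (ratr e)%:E * mu C.
Proof.
rewrite integralX (measureX mu) (measureX nu) -nneseriesZl// -nneseriesD//; last 2 first.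
- by move=> k _ _; apply: integral_ge0.
- by move=> k _ _; rewrite mule_ge0// lee_fin ltW.
apply: lee_nneseries => // k _.
apply: (le_trans (upper _ _)); first by rewrite mulr_ge0// ltW.
have -> : ratr (k.+1%:R * e) = (ratr (k%:R * e) + ratr e :> R)%R.
  by rewrite -rmorphD/=; congr ratr; rewrite -natr1 mulrDl mul1r.
by rewrite layer_step leeD2r//; exact: ge_integral_layer.
Qed.

Lemma layers_ge : \int[mu]_(w in C) g w <= nu C + (ratr (e *+ 2))%:E * mu C.
Proof.
rewrite integralX (measureX mu) (measureX nu) -nneseriesZl// -nneseriesD//; last first.
  by move=> k _ _; rewrite mule_ge0// lee_fin ler0q mulrn_wge0// ltW.
apply: lee_nneseries => [k _ _|k _]; first exact: integral_ge0.
apply: (le_trans (le_integral_layer _)).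
(* The bottom layer has no nonnegative [a] below it, and its integral is at most [e] times its
   measure. Layer [k + 1] uses [a = k e], two steps below its top; hence the doubled error term. *)
case: k => [|k].
  rewrite -[leLHS]add0e; apply: leeD => //; apply: lee_wpmul2r => //.
  by rewrite lee_fin ler_rat mul1r mulr2n lerDl ltW.
have -> : ratr (k.+2%:R * e) = (ratr (k%:R * e) + ratr (e *+ 2) :> R)%R.
  by rewrite -rmorphD/=; congr ratr; rewrite -!natr1 mulr2n; ring.
have fX : mu (X k.+1) \is a fin_num.
  rewrite ge0_fin_numE//; apply: le_lt_trans muC.
  by apply: le_measure; rewrite ?inE//; [exact: measurable_layer|move=> w []].
rewrite -(fineK fX) EFinD muleDl//.
rewrite fineK// leeD2r//; apply: lower.
by rewrite mulr_ge0//= ?ltW// ltr_pM2r// ltr_nat.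
Qed.

End mesh.

Lemma layers_eq : nu C = \int[mu]_(w in C) g w.
Proof.
have mesh (x : R) : (0 < x)%R -> exists2 e : rat, (0 < e)%R & (ratr (e *+ 2))%:E * mu C <= x%:E.
  move=> x0; have fC : mu C \is a fin_num by rewrite ge0_fin_numE.
  have m0 : (0 <= fine (mu C))%R by exact: fine_ge0.
  (* The factor 2 absorbs [e *+ 2]; adding 1 keeps the denominator positive when [C] is null. *)
  have [e] := rat_in_itvoo (x := 0%R) (y := (x / (2 * (fine (mu C) + 1)))%R)
    ltac:(by rewrite divr_gt0// mulr_gt0// ltr_wpDl).
  rewrite in_itv/= => /andP[e0 ex]; rewrite ltr0q in e0; exists e => //.
  rewrite -(fineK fC) -EFinM lee_fin rmorphMn /=.
  move: ex; rewrite ltr_pdivlMr ?mulr_gt0 ?ltr_wpDl// => /ltW; apply: le_trans.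
  have re0 : (0 <= ratr e :> R)%R by rewrite ler0q ltW.
  nra.
apply/eqP; rewrite eq_le; apply/andP; split; apply/lee_addgt0Pr => x /mesh[e e0 ex].
  apply: (le_trans (layers_le e0)); rewrite leeD2l//; apply: le_trans ex.
  by apply: lee_wpmul2r => //; rewrite lee_fin ler_rat mulr2n lerDl ltW.
by apply: (le_trans (layers_ge e0)); rewrite leeD2l.
Qed.

End layers.

(** * Projection of a time-constant set for a finite measure *)

Section projection.
Context {R : realType} d {W : measurableType d}.
Variable mu : {measure set W -> \bar R}.
Hypothesis mu_fin : mu setT < +oo.
Variable G : R -> set_system W.
Hypothesis sG : forall t, sigma_algebra setT (G t).
Hypothesis Gd : forall t u, (t <= u)%R -> G u `<=` G t.
Hypothesis Gm : forall t, G t `<=` measurable.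
Local Notation time := (measurableTypeR R).
Local Notation rect_space := (g_sigma_algebraType (is_rect G)).
Implicit Types (A : set (R * W)) (T : W -> R).

Let sR := rect_sigma_algebra G.

Lemma rect_sigma_measurable A : rect_sigma G A -> measurable (A : set (time * W)).
Proof.
apply: smallest_sub; first exact: sigma_algebra_measurable.
move=> _ [a [b [e [F [e0 GF ->]]]]].
rewrite (_ : rect a b F = `[a, b]%classic `*` F).
  by apply: measurableX; [exact: measurable_itv|exact: Gm GF].
by apply/seteqP; split=> z; rewrite /rect /= in_itv.
Qed.

Lemma rect_measurable_fun (p : R * W -> \bar R) :
  measurable_fun [set: rect_space] (p : rect_space -> _) ->
  measurable_fun [set: time * W] (p : time * W -> _).
Proof.
move=> mp _ Y mY; rewrite setTI; apply: rect_sigma_measurable.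
by have := mp measurableT Y mY; rewrite setTI.
Qed.

(** Up to a null set, [A] is contained in the graph of [T]. The time is a total real function and
    its domain is carried by [A], so restricting a time amounts to taking a subset of [A]. *)
Definition thin T A := [/\ measurable_fun [set: W] (T : W -> time), rect_sigma G A &
  exists N, [/\ measurable N, mu N = 0 & forall t w, ~ N w -> A (t, w) -> t = T w]].

Lemma thinS T A B : rect_sigma G B -> B `<=` A -> thin T A -> thin T B.
Proof.
move=> sB BA [mT _ [N [mN N0 hN]]]; split => //; exists N; split => // t w nN /BA.
exact: hN.
Qed.

Lemma measurable_at_time T A : measurable_fun [set: W] (T : W -> time) ->
  measurable (A : set (time * W)) -> measurable (at_time T A).
Proof.
move=> mT mA; have mp : measurable_fun [set: W] (fun w => (T w, w) : time * W).
  by apply: measurable_fun_pair.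
by have := mp measurableT A mA; rewrite setTI.
Qed.

Let at_fin T A : measurable_fun [set: W] (T : W -> time) ->
  measurable (A : set (time * W)) -> mu (at_time T A) \is a fin_num.
Proof.
move=> mT mA; rewrite ge0_fin_numE//; apply: (finite_mu mu_fin).
exact: measurable_at_time.
Qed.

(** For a thin set the projection agrees with [at_time T A] off a null set. Sections that capture
    any [c] below [mu (at_time T A)] therefore carry the bound over to the whole of it. *)
Lemma thin_lower_bound T A (F : set W) (r : R) (B : rat -> set W) :
  measurable F -> (0 <= r)%R -> (forall u, G (ratr u) (B u)) ->
  (forall u H, G (ratr u) H -> H `<=` B u -> r%:E * mu H <= mu (F `&` H)) ->
  thin T A -> A `<=` right_accumulation B ->
  r%:E * mu (at_time T A) <= mu (F `&` at_time T A).
Proof.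
move=> mF r0 GB hB [mT sA [N [mN N0 hN]]] AB.
have mA := rect_sigma_measurable sA; have mC := measurable_at_time mT mA.
have fC := at_fin mT mA.
have mFC : measurable (F `&` at_time T A) by exact: measurableI.
have fFC : mu (F `&` at_time T A) \is a fin_num.
  by rewrite ge0_fin_numE//; exact: (finite_mu mu_fin).
rewrite leNgt; apply/negP; rewrite -(fineK fC) -(fineK fFC) -EFinM lte_fin => lt.
have rpos : (0 < r)%R.
  rewrite lt_neqAle r0 andbT; apply/eqP => r00; move: lt; rewrite -r00 mul0r.
  by rewrite ltNge fine_ge0.
have mid (x y : R) : (x < y)%R -> exists c, (x < c < y)%R.
  by move=> xy; exists ((x + y) / 2)%R; apply/andP; split; lra.
(* If the bound fails, there is room for [c] below the measure of [at_time T A] with [r c] still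
   above that of its part in [F]. *)
have [c /andP[c1 c2]] := mid (fine (mu (F `&` at_time T A)) / r)%R
  (fine (mu (at_time T A))) ltac:(by rewrite ltr_pdivrMr// mulrC).
have cC : c%:E < shadow_capacity mu A.
  apply: (@lt_le_trans _ _ (mu (at_time T A))); first by rewrite -(fineK fC) lte_fin.
  apply: le_ereal_inf_tmp => _ [D [mD AD] <-]; apply: le_measure; rewrite ?inE//.
  by move=> w Aw; apply: AD; exists (T w).
have [K [mK KA cK rK]] := right_accumulation_lower_bound mu_fin sG Gd Gm mF r0 GB hB sA AB cC.
have : r%:E * c%:E <= mu (F `&` at_time T A).
  apply: le_trans (le_trans rK _); first by apply: lee_wpmul2l.
  rewrite -(measureU0 mFC mN N0); apply: le_measure; rewrite ?inE; first exact: measurableI.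
    exact: measurableU.
  move=> w [Fw /KA[t At]]; have [Nw|nN] := pselect (N w); first by right.
  by left; split => //; rewrite /at_time /= -(hN t).
rewrite -(fineK fFC) -EFinM lee_fin leNgt => /negP; apply.
by rewrite mulrC -ltr_pdivrMr.
Qed.

Definition projects A (p : R * W -> \bar R) := [/\ forall z, 0 <= p z <= 1,
  measurable_fun [set: rect_space] (p : rect_space -> \bar R) &
  forall T B, thin T B ->
    mu (at_time T (A `&` B)) = \int[mu]_(w in at_time T B) p (T w, w)].

Section constant_set.
Variable F : set W.
Hypothesis mF : measurable F.

Let hahn : exists P : rat -> rat -> set W, forall u q, [/\ G (ratr u) (P u q),
  forall H, G (ratr u) H -> H `<=` P u q -> (ratr q)%:E * mu H <= mu (F `&` H) &
  forall H, G (ratr u) H -> H `<=` ~` P u q -> mu (F `&` H) <= (ratr q)%:E * mu H].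
Proof.
have h (uq : rat * rat) := hahn_level mu_fin (sG (ratr uq.1)) (@Gm (ratr uq.1)) (ratr uq.2) mF.
by have [P hP] := choice h; exists (fun u q => P (u, q)) => u q; exact: (hP (u, q)).
Qed.

Let ratr1 : ratr 1 = 1%R :> R. Proof. exact: rmorph1. Qed.

Let clip (n : nat) : rat := if @unpickle rat n is Some q then
  if (0 <= q <= 1)%R then q else 0%R else 0%R.

Let clip01 n : (0 <= clip n <= 1)%R.
Proof. by rewrite /clip; case: unpickle => // q; case: ifP. Qed.

(* The projection is the supremum of the r 1_{E r}: where it exceeds r the lower
   bound holds for F with the sets P u r, and where it is below r it holds for the
   complement of F with the complements of the P u r. *)
Lemma projects_constant : exists p, projects (snd @^-1` F) p.
Proof.
have [P hP] := hahn.
pose E q : set (R * W) := right_accumulation (fun u => P u q).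
have sE q : rect_sigma G (E q) by apply: right_accumulation_sigma => u; case: (hP u q).
pose h n (z : rect_space) : \bar R := (ratr (clip n) * \1_(E (clip n)) z)%:E.
pose p z := esups (h ^~ z) 0%N.
have mh n : measurable_fun setT (h n).
  apply/measurable_EFinP; apply: measurable_funM => //; apply: measurable_indic.
  exact: sE.
have mp : measurable_fun [set: rect_space] p by exact: measurable_fun_esups.
have h_le n z : h n z <= p z by apply: ereal_sup_ubound; exists n.
have p01 z : 0 <= p z <= 1.
  apply/andP; split.
    by apply: le_trans (h_le 0%N z); rewrite lee_fin mulr_ge0// ler0q; case/andP: (clip01 0).
  apply: ge_ereal_sup => _ [n _ <-]; rewrite lee_fin.
  have /andP[c0 c1] := clip01 n; rewrite indicE; case: (z \in _); rewrite ?mulr0// mulr1.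
  by rewrite -[leRHS]ratr1 ler_rat.
have p_gt (q : rat) z : (0 <= q <= 1)%R -> E q z -> (ratr q)%:E <= p z.
  move=> q01 Ez; apply: le_trans (h_le (pickle q) z).
  by rewrite /h /clip pickleK q01 indicE mem_set// mulr1.
exists p; split => // T B tB.
have [mT sB [N [mN N0 hN]]] := tB.
have mB := rect_sigma_measurable sB; have mC := measurable_at_time mT mB.
have mg : measurable_fun setT (fun w => p (T w, w)).
  have := rect_measurable_fun mp; move/measurableT_comp; apply.
  exact: measurable_fun_pair.
have -> : at_time T (snd @^-1` F `&` B) = at_time T B `&` F.
  by rewrite setIC.
have layerE (b c : rat) : at_time T B `&` [set w | (ratr b)%:E <= p (T w, w) < (ratr c)%:E] =
    at_time T (B `&` [set z | (ratr b)%:E <= p z < (ratr c)%:E]) by [].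
have slayer (b c : rat) : rect_sigma G (B `&` [set z | (ratr b)%:E <= p z < (ratr c)%:E]).
  apply: (sigma_algebra_setI sR) => //.
  have -> : [set z | (ratr b)%:E <= p z < (ratr c)%:E] = p @^-1` `[(ratr b)%:E, (ratr c)%:E[%classic.
    by apply/seteqP; split=> z; rewrite /= in_itv.
  have := mp measurableT _ (emeasurable_itv `[(ratr b)%:E, (ratr c)%:E[).
  by rewrite setTI.
apply: (@layers_eq _ _ _ mu (mrestr mu mF) (at_time T B)) => //.
- exact: (finite_mu mu_fin).
- by move=> w; case/andP: (p01 (T w, w)).
- by move=> w; case/andP: (p01 (T w, w)) => _ /le_lt_trans; apply; rewrite ltry.
- move=> a b c /andP[a0 ab]; rewrite layerE.
  set B' := B `&` _.
  (* Where [p] is at least [b > a], some level [clip n >= a] has the point in its [E]. These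
     countably many pieces cover the layer and, made disjoint, each satisfy the bound with
     [clip n]. *)
  pose D n := B' `&` (E (clip n) `&` [set _ | (a <= clip n)%R]).
  have sD n : rect_sigma G (D n).
    apply: (sigma_algebra_setI sR) => //; first exact: slayer.
    apply: (sigma_algebra_setI sR) => //; have [_|_] := boolP (a <= clip n)%R.
      rewrite (_ : [set _ | _] = setT) -?subTset//; exact: (sigma_algebra_setT sR).
    by rewrite (_ : [set _ | _] = set0) -?subset0 => [|? []//]; case: sR.
  have BD : B' = \bigcup_n D n.
    apply/seteqP; split=> [z B'z|z [n _ []//]].
    have [_ /= /andP[bz _]] := B'z.
    have : (ratr a)%:E < p z by apply: lt_le_trans bz; rewrite lte_fin ltr_rat.
    move=> /ereal_sup_gt[_ [n _ <-]]; rewrite lte_fin => an; exists n => //; split => //.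
    move: an; rewrite indicE; case: (asboolP (E (clip n) z)) => Ez.
      rewrite mem_set// mulr1 ltr_rat => an; split => //=; exact: ltW.
    by rewrite memNset// mulr0 ltNge ler0q a0.
  pose D' := seqDU D.
  have sD' n : rect_sigma G (D' n) by exact: (@seqDU_measurable _ rect_space).
  have tD' n : thin T (D' n).
    apply: thinS tB => // z D'z.
    by have [[]] : D n z by exact: subset_seqDU D'z.
  have DD' : at_time T B' = \bigcup_n at_time T (D' n).
    by rewrite BD seqDU_bigcup_eq.
  have trivD' : trivIset setT (fun n => at_time T (D' n)).
    apply/trivIsetP => i j _ _ ij; have /trivIsetP/(_ i j I I ij) := trivIset_seqDU D.
    move=> D0; rewrite -subset0 => w [Di Dj].
    by have : (D' i `&` D' j) (T w, w) by []; rewrite /D' D0.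
  have mD' n : measurable (at_time T (D' n)).
    by apply: measurable_at_time => //; exact: rect_sigma_measurable.
  rewrite DD' !measure_bigcup// -nneseriesZl//; apply: lee_nneseries => [n _ _|n _].
    by rewrite mule_ge0// lee_fin ler0q.
  rewrite -[leRHS]/(mu (at_time T (D' n) `&` F)) setIC.
  apply: (@le_trans _ _ ((ratr (clip n))%:E * mu (at_time T (D' n)))).
    have [->|/set0P[w Dw]] := eqVneq (D' n) set0.
      by rewrite (_ : at_time T set0 = set0)// measure0 !mule0.
    apply: lee_wpmul2r => //; rewrite lee_fin ler_rat.
    by have [_ []] := subset_seqDU Dw.
  apply: (thin_lower_bound (B := fun u => P u (clip n)) mF _ _ _ (tD' n)) => //.
  + by rewrite ler0q; case/andP: (clip01 n).
  + by move=> u; case: (hP u (clip n)).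
  + by move=> u H; case: (hP u (clip n)) => _ + _; apply.
  + by move=> z D'z; have [_ []] : D n z by exact: subset_seqDU D'z.
- move=> b c c0; rewrite layerE; set B' := B `&` _.
  have sB' : rect_sigma G B' by exact: slayer.
  have tB' : thin T B' by apply: thinS tB => // z [].
  have mB' := measurable_at_time mT (rect_sigma_measurable sB').
  have fB' := at_fin mT (rect_sigma_measurable sB').
  have mFB' : measurable (at_time T B' `&` F) by exact: measurableI.
  have fFB' : mu (at_time T B' `&` F) \is a fin_num.
    by rewrite ge0_fin_numE//; exact: (finite_mu mu_fin).
  have FB'le : mu (at_time T B' `&` F) <= mu (at_time T B').
    by apply: le_measure; rewrite ?inE.
  (* Beyond 1 the bound is trivial. For [c <= 1] the level [c] is among those in the supremum, and
     [1 - c] is a legitimate nonnegative level for the complement of [F]. *)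
  rewrite -[leLHS]/(mu (at_time T B' `&` F)); have [c1|c1] := ltP 1%R c.
    apply: le_trans FB'le _; rewrite -[leLHS]mul1e; apply: lee_wpmul2r => //.
    by rewrite lee_fin -[leLHS]ratr1 ler_rat ltW.
  have mCF : measurable (~` F) by exact: measurableC.
  have split_F (H : set W) : measurable H -> fine (mu H) = (fine (mu (H `&` F)) + fine (mu (~` F `&` H)))%R.
    move=> mH; have mHF : measurable (H `&` F) by exact: measurableI.
    have mHCF : measurable (~` F `&` H) by exact: measurableI.
    rewrite -fineD ?ge0_fin_numE//; try exact: (finite_mu mu_fin).
    congr fine; rewrite -measureU//.
      by rewrite [~` F `&` H]setIC -setIUr setUCr setIT.
    by rewrite -subset0 => w [[_ Fw] []].
  have fin (H : set W) : measurable H -> mu H \is a fin_num.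
    by move=> mH; rewrite ge0_fin_numE//; exact: (finite_mu mu_fin).
  have rc0 : (0 <= 1 - ratr c :> R)%R by rewrite subr_ge0 -[leRHS]ratr1 ler_rat.
  have : (1 - ratr c)%:E * mu (at_time T B') <= mu (~` F `&` at_time T B').
    apply: (thin_lower_bound (B := fun u => ~` P u c) mCF rc0 _ _ tB').
    + by move=> u; apply: (sigma_algebra_setC (sG _)); case: (hP u c).
    + move=> u H GH HP; have mH := Gm GH.
      have := (hP u c) => -[_ _ /(_ H GH HP)].
      have mFH : measurable (F `&` H) by exact: measurableI.
      have mCFH : measurable (~` F `&` H) by exact: measurableI.
      rewrite -(fineK (fin _ mH)) -(fineK (fin _ mFH)) -(fineK (fin _ mCFH)).
      rewrite -!EFinM !lee_fin (split_F H)// (setIC H F); nra.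
    (* If no complement occurred in []t, t + e[], then [w] would be in [P u c] for all rational [u]
       there, so [(t, w)] would be in [E c] and [p] would be at least [c]. *)
    + move=> [t w] B'z e e0; apply: contrapT => nE.
      have [_ /= /andP[_ pc]] := B'z.
      move: pc; rewrite ltNge => /negP; apply; apply: p_gt; first by rewrite c0.
      move=> e' e'0.
      have [u] := rat_in_itvoo (x := t) (y := (t + Num.min e e')%R)
        ltac:(by rewrite ltrDl lt_min e0).
      rewrite in_itv/= => /andP[tu ut]; exists u; split.
        by rewrite tu (lt_le_trans ut)// lerD2l ge_min lexx orbT.
      apply: contrapT => nP; apply: nE; exists u; split => //.
      by rewrite tu (lt_le_trans ut)// lerD2l ge_min lexx.
  have mCFB' : measurable (~` F `&` at_time T B') by exact: measurableI.
  rewrite -(fineK fB') -(fineK fFB') -(fineK (fin _ mCFB')).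
  rewrite -!EFinM !lee_fin (split_F _ mB'); nra.
Qed.

End constant_set.
End projection.

(** * Extension to product-measurable sets *)

Section projection_product.
Context {R : realType} d {W : measurableType d}.
Variable mu : {measure set W -> \bar R}.
Hypothesis mu_fin : mu setT < +oo.
Variable G : R -> set_system W.
Hypothesis sG : forall t, sigma_algebra setT (G t).
Hypothesis Gd : forall t u, (t <= u)%R -> G u `<=` G t.
Hypothesis Gm : forall t, G t `<=` measurable.
Local Notation time := (measurableTypeR R).
Local Notation rect_space := (g_sigma_algebraType (is_rect G)).
Implicit Types (A : set (R * W)) (T : W -> R).

Let sR := rect_sigma_algebra G.

Lemma rect_sigma_fst (B : set time) : measurable B -> rect_sigma G (fst @^-1` B).
Proof.
suff h : (measurable : set_system time) `<=` [set B | rect_sigma G (fst @^-1` B)].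
  by move=> mB; exact: h mB.
apply: smallest_sub.
- split => /=; first by rewrite preimage_set0; case: sR.
  + by move=> A sA; rewrite setTD preimage_setC; exact: (sigma_algebra_setC sR).
  + by move=> A sA; rewrite preimage_bigcup; exact: (sigma_algebra_countU sR).
- move=> _ [[a b] _ <-] /=.
  rewrite (_ : _ @^-1` _ = \bigcup_(n : nat) rect (a + n.+1%:R^-1) b setT).
    apply: (sigma_algebra_countU sR) => n; apply: sub_sigma_algebra.
    exists (a + n.+1%:R^-1)%R, b, 1%R, setT; split => //.
    exact: (sigma_algebra_setT (sG _)).
  apply/seteqP; split=> -[t w] /=; rewrite in_itv /=.
    move=> /andP[at_ tb]; have ta : (0 < t - a)%R by rewrite subr_gt0.
    exists (Num.trunc (t - a)^-1) => //; split => //=; rewrite tb andbT -lerBrDl.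
    rewrite -[leRHS]invrK lef_pV2 ?posrE ?invr_gt0//.
    exact/ltW/truncnS_gt.
  move=> [n _ [/= /andP[at_ tb] _]]; rewrite tb andbT (lt_le_trans _ at_)//.
  by rewrite ltrDl invr_gt0 ltr0n.
Qed.

Lemma measurable_at T (p : R * W -> \bar R) : measurable_fun [set: W] (T : W -> time) ->
  measurable_fun [set: rect_space] (p : rect_space -> \bar R) ->
  measurable_fun [set: W] (fun w => p (T w, w)).
Proof.
move=> mT /(rect_measurable_fun Gm) mp.
by move/measurableT_comp : mp; apply; exact: measurable_fun_pair.
Qed.

Lemma thin_measurable T B : thin mu G T B -> measurable (at_time T B).
Proof.
by move=> [mT sB _]; apply: measurable_at_time => //; exact: (rect_sigma_measurable Gm).
Qed.

Lemma thinI T A B : rect_sigma G A -> thin mu G T B -> thin mu G T (A `&` B).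
Proof.
move=> sA tB; apply: thinS (tB) => [|z []//]; have [_ sB _] := tB.
exact: (sigma_algebra_setI sR).
Qed.

Lemma projects_rect (B : set time) (F : set W) : measurable B -> measurable F ->
  exists p, projects mu G (B `*` F) p.
Proof.
move=> mB mF; have [p [p01 mp hp]] := projects_constant mu_fin sG Gd Gm mF.
have sB := rect_sigma_fst mB.
exists (p \_ (fst @^-1` B)); split.
- by move=> z; rewrite /patch; case: ifP => // _; rewrite lexx lee_fin ler01.
- by apply: (measurable_restrictT (p : rect_space -> _) (sB : measurable (_ : set rect_space))).1; exact: measurable_funTS mp.
move=> T D tD; have tBD := thinI sB tD.
rewrite (_ : at_time T _ = at_time T (snd @^-1` F `&` (fst @^-1` B `&` D))); last first.
  by rewrite setIA; congr (at_time _ (_ `&` _)); apply/seteqP; split=> z [].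
rewrite hp// (_ : at_time T (_ `&` D) = at_time T D `&` at_time T (fst @^-1` B)).
  rewrite integral_mkcondr; apply: eq_integral => w _.
  by rewrite /patch.
by rewrite setIC.
Qed.

Lemma projectsC A p : measurable (A : set (time * W)) ->
  projects mu G A p -> projects mu G (~` A) (fun z => 1 - p z).
Proof.
move=> mA [p01 mp hp].
have pfin z : p z \is a fin_num.
  by case/andP: (p01 z) => p0 p1; rewrite ge0_fin_numE// (le_lt_trans p1)// ltry.
split.
- move=> z; case/andP: (p01 z) => p0 p1.
  rewrite suber_ge0// p1 /= -[leRHS]sube0; apply: leeB => //.
- exact: emeasurable_funB.
move=> T B tB; have mB := thin_measurable tB; have [mT sB _] := tB.
have mpT := measurable_at mT mp.
have mAB : measurable (at_time T (A `&` B)).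
  apply: measurable_at_time => //; apply: measurableI => //.
  exact: (rect_sigma_measurable Gm).
have mAcB : measurable (at_time T (~` A `&` B)).
  apply: measurable_at_time => //; apply: measurableI; first exact: measurableC.
  exact: (rect_sigma_measurable Gm).
have fin X : measurable X -> mu X \is a fin_num.
  by move=> mX; rewrite ge0_fin_numE//; exact: (finite_mu mu_fin).
have E1 : mu (at_time T (~` A `&` B)) + mu (at_time T (A `&` B)) = mu (at_time T B).
  rewrite -measureU//.
    congr (mu _); apply/seteqP; split=> [w [[]|[]]//|w Bw].
    by have [Aw|nA] := pselect (A (T w, w)); [right|left].
  by rewrite -subset0 => w [[nA _] [Aw _]].
have E2 : \int[mu]_(w in at_time T B) (1 - p (T w, w)) + \int[mu]_(w in at_time T B) p (T w, w) =
    mu (at_time T B).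
  rewrite -ge0_integralD//.
  - under eq_integral do rewrite subeK//.
    by rewrite integral_cst// mul1e.
  - by move=> w _; case/andP: (p01 (T w, w)) => _ ?; rewrite suber_ge0.
  - by apply: measurable_funTS; apply: emeasurable_funB.
  - by move=> w _; case/andP: (p01 (T w, w)).
  - exact: measurable_funTS.
move: E2; rewrite -E1 -hp// => /(congr1 (fun x => x - mu (at_time T (A `&` B)))).
by rewrite !addeK ?fin.
Qed.

(** The sum [s] has the right integrals, but nothing bounds it by 1 pointwise, and complementation
    needs values in [[0, 1]]. Truncation changes no integral: over the part where [s > 1], the
    integral of [s] is the measure of a subset of that part, hence at most its measure, and also at
    least its measure. *)
Lemma projects_bigcup (A : nat -> set (R * W)) p :
  (forall n, measurable (A n : set (time * W))) -> trivIset setT A ->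
  (forall n, projects mu G (A n) (p n)) ->
  projects mu G (\bigcup_n A n) (fun z => mine (\sum_(n <oo) p n z) 1).
Proof.
move=> mA tA hA; pose s z := \sum_(n <oo) p n z.
have p0 n z : 0 <= p n z by have [/(_ z)/andP[]] := hA n.
have s0 z : 0 <= s z by exact: nneseries_ge0.
have ms : measurable_fun [set: rect_space] (s : rect_space -> _).
  rewrite /s; apply: (@ge0_emeasurable_sum _ _ _ _ (fun n (z : rect_space) => p n z) predT) => //.
  by move=> n _; case: (hA n).
have mUA : measurable (\bigcup_n A n : set (time * W)) by exact: bigcupT_measurable.
have hs T B : thin mu G T B ->
    mu (at_time T (\bigcup_n A n `&` B)) = \int[mu]_(w in at_time T B) s (T w, w).
  move=> tB; have mB := thin_measurable tB; have [mT sB _] := tB.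
  have -> : at_time T (\bigcup_n A n `&` B) = \bigcup_n at_time T (A n `&` B).
    by rewrite setI_bigcupl.
  rewrite measure_bigcup//; last 2 first.
  - move=> n _; apply: measurable_at_time => //; apply: measurableI => //.
    exact: (rect_sigma_measurable Gm).
  - apply/trivIsetP => i j _ _ ij; have /trivIsetP/(_ i j I I ij) A0 := tA.
    rewrite -subset0 => w [[Ai _] [Aj _]].
    by have : (A i `&` A j) (T w, w) by []; rewrite A0.
  rewrite /s integral_nneseries//.
    rewrite (eq_eseriesl (Q := predT)); last by move=> n; rewrite in_setT.
    by apply: eq_eseriesr => n _; case: (hA n) => _ _ ->.
  move=> n; apply: measurable_funTS; apply: measurable_at => //.
  by case: (hA n).
split.
- move=> z; rewrite le_min s0 ge_min lexx orbT lee_fin ler01 //.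
- exact: measurable_mine.
move=> T B tB; have [mT sB _] := tB.
pose C : set (R * W) := [set z | 1 < s z].
have sC : rect_sigma G C.
  have := ms measurableT _ (emeasurable_itv `]1, +oo[); rewrite setTI.
  by rewrite (_ : _ @^-1` _ = C)//; apply/seteqP; split=> z; rewrite /= in_itv /= andbT.
have tCB := thinI sC tB; have tCcB := thinI (sigma_algebra_setC sR sC) tB.
have mCB := thin_measurable tCB; have mCcB := thin_measurable tCcB.
have mUB : measurable (at_time T (\bigcup_n A n `&` (C `&` B))).
  apply: measurable_at_time => //; apply: measurableI => //.
  by apply: (rect_sigma_measurable Gm); case: tCB.
have msT := measurable_at mT ms.
have BE : at_time T B = at_time T (C `&` B) `|` at_time T (~` C `&` B).
  apply/seteqP; split=> [w Bw|w [[]|[]]//].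
  by have [Cw|nC] := pselect (C (T w, w)); [left|right].
have dis : [disjoint at_time T (C `&` B) & at_time T (~` C `&` B)].
  by apply/disj_setPS => w [[Cw _] [nC _]].
rewrite hs// BE !ge0_integral_setU//; last 3 first.
- by apply: measurable_funTS; apply: measurable_mine.
- by move=> w _; rewrite le_min s0 lee_fin ler01.
- exact: measurable_funTS.
congr (_ + _); last first.
  apply: eq_integral => w; rewrite inE => -[nC _]; rewrite min_l// leNgt; exact/negP.
transitivity (mu (at_time T (C `&` B))); last first.
  rewrite -[LHS]mul1e -integral_cst//; apply: eq_integral => w; rewrite inE => -[Cw _].
  by rewrite min_r// ltW.
apply/eqP; rewrite eq_le -{1}hs//; apply/andP; split.
  by apply: le_measure; rewrite ?inE// => w [].
rewrite -[leLHS]mul1e -integral_cst//; apply: ge0_le_integral => //.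
- exact: measurable_funTS.
- by move=> w [Cw _]; exact: ltW.
Qed.

Theorem projects_exists A : measurable (A : set (time * W)) -> exists p, projects mu G A p.
Proof.
rewrite measurable_prod_measurableType.
apply: (@dynkin_induction _ (time * W)%type _ (fun A => exists p, projects mu G A p)).
- exact: measurable_prod_measurableType.
- move=> _ _ [B mB [F mF <-]] [B' mB' [F' mF' <-]].
  exists (B `&` B'); first exact: measurableI.
  by exists (F `&` F'); [exact: measurableI|rewrite setXI].
- by rewrite -setXTT; exact: projects_rect.
- by move=> _ [B mB [F mF <-]]; exact: projects_rect.
- by move=> B mB [p hp]; exists (fun z => 1 - p z); exact: projectsC.
- move=> F mF tF hF; have [p hp] := choice hF.
  by eexists; exact: (projects_bigcup mF tF hp).
Qed.

End projection_product.

(** * Copredictable processes on the Kuznetsov space *)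

Local Notation coord := Defs.coord.



Section equal_up_to_null_fibers.
Context {R : realType} d {W : measurableType d}.
Variable Q : {measure set W -> \bar R}.

Lemma negligible_countU (I : countType) (N : I -> set W) :
  (forall i, Q.-negligible (N i)) -> Q.-negligible (\bigcup_i N i).
Proof.
move=> nN; rewrite (_ : \bigcup_i N i = \bigcup_n if unpickle n is Some i then N i else set0).
  by apply: negligible_bigcup => n; case: unpickle => // *; exact: negligible_set0.
apply/seteqP; split=> [x [i _ Nx]|x [n _]]; first by exists (pickle i); rewrite ?pickleK.
by case: unpickle => // i Nx; exists i.
Qed.

Variables (X : Type) (f : X -> W).

(* For f = snd this is equality up to evanescence, for f = id almost sure equality. *)
Definition fiber_eq (A B : set X) := Q.-negligible [set w | exists2 x, f x = w & ~ (A x <-> B x)].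

Lemma fiber_eq_refl A : fiber_eq A A.
Proof.
rewrite /fiber_eq (_ : [set _ | _] = set0); first exact: negligible_set0.
by rewrite -subset0 => w [x _]; apply.
Qed.

Lemma sigma_algebra_fiber_eq (S : set_system X) : sigma_algebra setT S ->
  sigma_algebra setT [set A | exists2 B, S B & fiber_eq A B].
Proof.
move=> sS; split => /=.
- by exists set0; [case: sS|exact: fiber_eq_refl].
- move=> A [B SB AB]; exists (~` B); first exact: sigma_algebra_setC.
  apply: negligibleS AB => w [x fx h]; exists x => // AB; apply: h.
  by rewrite setTD /setC /=; split=> nA /AB.
- move=> A hA; have [B hB] := choice (fun n => let: ex_intro2 B SB AB := hA n in
    ex_intro (fun B => S B /\ fiber_eq (A n) B) B (conj SB AB)).
  exists (\bigcup_n B n); first by apply: (sigma_algebra_countU sS) => n; case: (hB n).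
  apply: (negligibleS _ (negligible_countU (fun n => (hB n).2))).
  move=> w [x fx h]; apply: contrapT => nN; apply: h.
  by split=> -[n _ H]; exists n => //; apply: contrapT => nH; apply: nN; exists n => //;
    exists x => //; tauto.
Qed.

End equal_up_to_null_fibers.

Section paths.
Context {R : realType} {E : ptopologicalType}.
Local Notation W := (kuznetsov_path R E).
Local Notation time := (measurableTypeR R).
Local Notation kuz := (kuznetsov_space R E).
Local Notation G := (@G0_after R E).

Lemma G0_after_sigma_algebra t : sigma_algebra setT (G t).
Proof. exact: smallest_sigma_algebra. Qed.

Lemma G0_after_decr (t u : R) : (t <= u)%R -> G u `<=` G t.
Proof.
move=> tu; apply: sub_sigma_algebra2 => A [s /= us As]; exists s => //=.
exact: le_lt_trans us.
Qed.

Lemma G0_after_measurable t : G t `<=` (measurable : set_system kuz).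
Proof. by apply: sub_sigma_algebra2 => A [s _ As]; exists s. Qed.

Lemma G0_after_coord (t s : R) (B : set (borel (cemetery E))) : measurable B -> (t < s)%R ->
  G t (coord s @^-1` B).
Proof.
move=> mB ts; apply: sub_sigma_algebra; exists s => //; exists B => //.
by rewrite setTI.
Qed.

Lemma measurable_Some (B : set (borel E)) : measurable B ->
  measurable ((Some @` B) : set (borel (cemetery E))).
Proof.
have mS : measurable ((Some @` setT) : set (borel (cemetery E))).
  apply: sub_sigma_algebra; change (cemetery_open (Some @` [set: E])).
  rewrite /cemetery_open /= (_ : _ @^-1` _ = setT); first exact: openT.
  by rewrite -subTset => x _; exists x.
suff h : (measurable : set_system (borel E)) `<=`
    [set B | measurable ((Some @` B) : set (borel (cemetery E)))] by exact: h.
apply: smallest_sub.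
- split => /=; first by rewrite image_set0.
  + move=> A mA; rewrite (_ : Some @` (setT `\` A) = (Some @` setT) `\` (Some @` A)).
      exact: measurableD.
    apply/seteqP; split=> [x [y [_ nA] <-]|x [[y _ <-] nA]].
      by split; [exists y|move=> [z Az [zy]]; apply: nA; rewrite -zy].
    by exists y => //; split => // Ay; apply: nA; exists y.
  + by move=> A mA; rewrite image_bigcup; exact: bigcupT_measurable.
- move=> A oA; apply: sub_sigma_algebra; change (cemetery_open (Some @` A)).
  rewrite /cemetery_open /= (_ : _ @^-1` _ = A) //.
  by apply/seteqP; split=> [x [y Ay [<-]]|x Ax]//; exists x.
Qed.

(** The path lives on an open interval, so survival beyond [t] is witnessed at a rational time. This
    makes survival a countable union of events of [G t]. *)
Lemma lt_deathP (t : R) (w : W) :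
  t%:E < death w <-> exists2 q : rat, (t < ratr q)%R & coord (ratr q) w <> Delta.
Proof.
split=> [|[q tq wq]]; last first.
  apply: (@lt_le_trans _ _ (ratr q)%:E); first by rewrite lte_fin.
  by apply: ereal_sup_ubound; exists (ratr q).
move=> /ereal_sup_gt[_ [s /= ws <-]]; rewrite lte_fin => ts.
have [a [b hab]] := kuznetsov_pathP w.
have /andP[as_ sb] : a < s%:E < b by apply: contrapT => /(hab s).2.
have [c sc cb] : exists2 c : R, (s < c)%R & c%:E <= b.
  case: b {hab} sb => [b| |] //; first by rewrite lte_fin => sb; exists b.
  by move=> _; exists (s + 1)%R; rewrite ?ltrDl// leey.
have [q] := rat_in_itvoo sc; rewrite in_itv/= => /andP[sq qc]; exists q.
  exact: lt_trans sq.
suff h : a < (ratr q)%:E < b by have [] := (hab (ratr q)).1 h.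
rewrite (lt_trans as_) ?lte_fin//=.
by rewrite (lt_le_trans _ cb)// lte_fin.
Qed.

Definition alive : set (R * W) := [set z | z.1%:E < death z.2].

Lemma aliveE : alive = \bigcup_(q : rat) [set z | (z.1 < ratr q)%R /\ coord (ratr q) z.2 <> Delta].
Proof.
apply/seteqP; split=> [[t w] /lt_deathP[q tq wq]|[t w] [q _ [tq wq]]]; first by exists q.
by apply/lt_deathP; exists q.
Qed.

Lemma rect_sigma_halfopen (a b : R) (H : set W) : (forall t, (t < b)%R -> G t H) ->
  rect_sigma G [set z | (a <= z.1 < b)%R /\ H z.2].
Proof.
move=> GH; have sR := rect_sigma_algebra G.
rewrite (_ : [set _ | _] = \bigcup_(n : nat) rect a (b - n.+1%:R^-1) H).
  apply: (sigma_algebra_countU sR) => n; apply: sub_sigma_algebra.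
  (* Half of the distance left before [b] serves as margin, so that [H] is needed only at times
     strictly before [b]. *)
  exists a, (b - n.+1%:R^-1)%R, (n.+1%:R^-1 / 2)%R, H.
  have n0 : (0 < n.+1%:R^-1 :> R)%R by rewrite invr_gt0 ltr0n.
  move: (n.+1%:R^-1)%R n0 => i i0.
  by split => //; [rewrite divr_gt0|apply: GH; lra].
apply/seteqP; split=> -[t w] /=.
  move=> [/andP[at_ tb] Hw]; have bt : (0 < b - t)%R by rewrite subr_gt0.
  exists (Num.trunc (b - t)^-1) => //; split => //=; rewrite at_ /= lerBrDl -lerBrDr.
  rewrite -[leRHS]invrK lef_pV2 ?posrE ?invr_gt0//; exact/ltW/truncnS_gt.
move=> [n _ [/= /andP[at_ tb] Hw]]; rewrite at_ (le_lt_trans tb)//.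
by rewrite gtrBl invr_gt0 ltr0n.
Qed.

Lemma rect_sigma_lt (b : R) (H : set W) : (forall t, (t < b)%R -> G t H) ->
  rect_sigma G [set z | (z.1 < b)%R /\ H z.2].
Proof.
move=> GH; have sR := rect_sigma_algebra G.
rewrite (_ : [set _ | _] = \bigcup_(n : nat) [set z | (- n%:R <= z.1 < b)%R /\ H z.2]).
  by apply: (sigma_algebra_countU sR) => n; exact: rect_sigma_halfopen.
apply/seteqP; split=> -[t w] /= => [[tb Hw]|[n _ [/andP[_ tb] Hw]]]//.
exists (Num.trunc `|t|).+1 => //; split => //; rewrite tb andbT.
by rewrite lerNl ltW// (le_lt_trans (ler_norm _))// normrN truncnS_gt.
Qed.

Lemma G0_after_not_Delta (q t : R) : (t < q)%R -> G t [set w | coord q w <> Delta].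
Proof.
move=> tq; rewrite (_ : [set _ | _] = coord q @^-1` (Some @` setT)).
  by apply: G0_after_coord => //; exact: measurable_Some.
apply/seteqP; split=> w /=; last by move=> [x _ <-].
by case: (coord q w) => // x _; exists x.
Qed.

Lemma rect_sigma_alive : rect_sigma G alive.
Proof.
rewrite aliveE; apply: (sigma_algebra_countU (rect_sigma_algebra G)) => q.
by apply: (rect_sigma_lt (H := [set w | coord (ratr q) w <> Delta])) => t; exact: G0_after_not_Delta.
Qed.

Lemma measurable_alive : measurable (alive : set (time * kuz)).
Proof. exact: (@rect_sigma_measurable R _ kuz G G0_after_measurable _ rect_sigma_alive). Qed.

Lemma copredictable0_right_continuous (A : set (R * W)) :
  A `<=` alive -> measurable (A : set (time * kuz)) ->
  (forall t, G t [set w | A (t, w)]) ->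
  (forall t w, \forall s \near t^'+, A (s, w) <-> A (t, w)) -> copredictable0 A.
Proof.
move=> Aa mA GA rA; apply: sub_sigma_algebra.
exists (\1_A : R * W -> R).
  split.
  - exact: (measurable_indic mA).
  - move=> t _ [B mB <-]; rewrite setTI.
    rewrite (_ : _ @^-1` B = ([set w | A (t, w)] `&` [set _ | B 1%R]) `|`
       (~` [set w | A (t, w)] `&` [set _ | B 0%R])).
      have cst (P : Prop) : G t [set _ | P].
        have [p|np] := pselect P.
          by rewrite (_ : [set _ | _] = setT) -?subTset//; exact: (sigma_algebra_setT (G0_after_sigma_algebra t)).
        by rewrite (_ : [set _ | _] = set0) -?subset0//; case: (G0_after_sigma_algebra t).
      apply: (sigma_algebra_setU (G0_after_sigma_algebra t));
        apply: (sigma_algebra_setI (G0_after_sigma_algebra t)) => //.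
      by apply: (sigma_algebra_setC (G0_after_sigma_algebra t)).
    apply/seteqP; split=> w /=; rewrite indicE; case: (asboolP (A (t, w))) => At.
    + by rewrite mem_set// => B1; left.
    + by rewrite memNset// => B0; right.
    + by rewrite mem_set// => -[[]|[]].
    + by rewrite memNset// => -[[]|[]].
  - move=> w t; apply: cvg_near_cst; apply: filterS (rA t w) => s h.
    rewrite !indicE; congr (_%:R); congr nat_of_bool.
    by apply/idP/idP; rewrite !inE => /h.
  - move=> t w dt; rewrite indicE memNset// => /Aa; rewrite /alive /=.
    by rewrite ltNge dt.
exists [set 1%R]; first exact: measurable_set1.
rewrite setTI; apply/seteqP; split=> z /=; rewrite indicE; case: (asboolP (A z)) => Az.
- by [].
- by rewrite memNset// => /esym/eqP; rewrite oner_eq0.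
- by rewrite mem_set.
- by [].
Qed.

Let near_ge (a t : R) : \forall s \near t^'+, (a <= s)%R <-> (a <= t)%R.
Proof.
have [ta|at_] := ltP t a.
  by near=> s; split=> //; rewrite leNgt => /negP[]; near: s; exact: nbhs_right_lt.
near=> s; split=> // _; apply: (le_trans at_); apply: ltW; near: s; exact: nbhs_right_gt.
Unshelve. all: by end_near. Qed.

Let near_lt (b t : R) : \forall s \near t^'+, (s < b)%R <-> (t < b)%R.
Proof.
have [tb|bt] := ltP t b.
  by near=> s; split=> // _; near: s; exact: nbhs_right_lt.
near=> s; split=> //; rewrite ltNge => /negP[]; apply: (le_trans bt); apply: ltW.
by near: s; exact: nbhs_right_gt.
Unshelve. all: by end_near. Qed.

Let near_alive (t : R) (w : W) : \forall s \near t^'+, alive (s, w) <-> alive (t, w).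
Proof.
have gt : \forall s \near t^'+, (t < s)%R by exact: nbhs_right_gt.
have [/lt_deathP[q tq wq]|nA] := pselect (alive (t, w)).
  near=> s; split=> _; apply/lt_deathP; exists q => //.
  by near: s; exact: nbhs_right_lt.
near=> s; split=> // As; case: nA; apply: lt_trans As; rewrite lte_fin.
by near: s; exact: nbhs_right_gt.
Unshelve. all: by end_near. Qed.

Lemma G0_after_alive t : G t [set w | alive (t, w)].
Proof.
rewrite aliveE.
rewrite (_ : [set w | _] = \bigcup_(q : rat) [set w | (t < ratr q)%R /\ coord (ratr q) w <> Delta])//.
apply: (sigma_algebra_countU (G0_after_sigma_algebra t)) => q.
have [tq|qt] := ltP t (ratr q).
  rewrite (_ : [set _ | _] = [set w | coord (ratr q) w <> Delta]).
    exact: G0_after_not_Delta.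
  by apply/seteqP; split=> w // [].
by rewrite (_ : [set _ | _] = set0) -?subset0 => [|w []//]; case: (G0_after_sigma_algebra t).
Qed.

Lemma copredictable0_alive : copredictable0 alive.
Proof.
apply: copredictable0_right_continuous => //; first exact: measurable_alive.
exact: G0_after_alive.
Qed.

Lemma copredictable0_sigma_algebra : sigma_algebra setT (@copredictable0 R E).
Proof. exact: smallest_sigma_algebra. Qed.

(** The indicator of [[a, b] x F] is not right continuous at [b]. Those of [[a, b + e / (n +
    1)[ x F] are, and they are adapted because [F] is already in [G (b + e)]. Intersecting with
    [alive] makes them vanish from death on. *)
Lemma rect_sigma_copredictable0 (A : set (R * W)) : rect_sigma G A -> copredictable0 (A `&` alive).
Proof.
have sC := copredictable0_sigma_algebra.
suff h : rect_sigma G `<=` [set A | copredictable0 (A `&` alive)] by exact: h.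
apply: smallest_sub => /=.
- split => /=; first by rewrite set0I; case: sC.
  + move=> B CB; rewrite (_ : _ `&` alive = alive `\` (B `&` alive)).
      by apply: (sigma_algebra_setD sC) => //; exact: copredictable0_alive.
    apply/seteqP; split=> [z [[_ nB] az]|z [az nBa]]; first by split=> // -[].
    by split=> //; split=> // Bz; exact: nBa.
  + by move=> B CB; rewrite setI_bigcupl; exact: (sigma_algebra_countU sC).
move=> _ [a [b [e [F [e0 GF ->]]]]] /=.
have ne0 (n : nat) : (0 < e / n.+1%:R)%R by rewrite divr_gt0.
have nee (n : nat) : (e / n.+1%:R <= e)%R.
  by rewrite ler_pdivrMr ?ltr0n//; apply: ler_peMr; [exact: ltW|rewrite ler1n].
rewrite (_ : _ `&` alive = \bigcap_(n : nat)
  ([set z | (a <= z.1 < b + e / n.+1%:R)%R /\ F z.2] `&` alive)).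
  apply: (sigma_algebra_countI sC) => n; apply: copredictable0_right_continuous.
  - by move=> z [].
  - apply: measurableI; last exact: measurable_alive.
    apply: (@rect_sigma_measurable R _ kuz G G0_after_measurable); apply: rect_sigma_halfopen => t tb.
    apply: G0_after_decr GF; apply: ltW; apply: (lt_le_trans tb).
    by rewrite lerD2l.
  - move=> t; have sG := G0_after_sigma_algebra t.
    rewrite (_ : [set w | _] = [set w | (a <= t < b + e / n.+1%:R)%R /\ F w] `&` [set w | alive (t, w)])//.
    apply: (sigma_algebra_setI sG).
      have [/andP[at_ tb]|h] := boolP (a <= t < b + e / n.+1%:R)%R.
        rewrite (_ : [set w | _] = F); last by apply/seteqP; split=> w // [].
        apply: G0_after_decr GF; apply: ltW; apply: (lt_le_trans tb).
        by rewrite lerD2l.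
      by rewrite (_ : [set _ | _] = set0) -?subset0 => [|w []//]; case: sG.
    exact: G0_after_alive.
  - move=> t w; near=> s.
    have h1 : (a <= s)%R <-> (a <= t)%R by near: s; exact: near_ge.
    have h2 : (s < b + e / n.+1%:R)%R <-> (t < b + e / n.+1%:R)%R by near: s; exact: near_lt.
    have h3 : alive (s, w) <-> alive (t, w) by near: s; exact: near_alive.
    split=> -[[/= /andP[? ?] ?] ?]; split; try exact/h3; split=> //=;
      by apply/andP; split; [exact/h1|exact/h2].
apply/seteqP; split=> [[t w] [[/= /andP[at_ tb] Fw] al] n _|[t w] h].
  by split => //; split => //=; rewrite at_ (le_lt_trans tb)// ltrDl.
have [[/= /andP[at_ _] Fw] al] := h 0%N I; split => //; split => //=; rewrite at_ /= leNgt.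
apply/negP => bt; have bt0 : (0 < t - b)%R by rewrite subr_gt0.
(* This [n] satisfies [e / (n + 1) < t - b]. *)
have [[/= /andP[_ tn] _] _] := h (Num.trunc (e / (t - b))) I.
have := truncnS_gt (e / (t - b))%R; rewrite ltr_pdivrMr// mulrC -ltr_pdivrMr ?ltr0n//.
by rewrite ltrBrDl => /(lt_trans tn); rewrite ltxx.
Unshelve. all: by end_near. Qed.

End paths.

(** * Copredictable sets modulo evanescence *)

Section up_to_evanescence.
Context {R : realType} {E : ptopologicalType}.
Local Notation W := (kuznetsov_path R E).
Local Notation time := (measurableTypeR R).
Local Notation kuz := (kuznetsov_space R E).
Local Notation G := (@G0_after R E).
Variable Q : {measure set kuz -> \bar R}.

Lemma Gm_after_fiber_eq t : Gm_after Q t `<=` [set A | exists2 B, G t B & fiber_eq Q id A B].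
Proof.
apply: smallest_sub.
  by apply: sigma_algebra_fiber_eq; exact: G0_after_sigma_algebra.
move=> A [GA|nA]; first by exists A => //; exact: fiber_eq_refl.
exists set0; first by case: (@G0_after_sigma_algebra R E t).
apply: negligibleS nA => w [x <- h]; apply: contrapT => nAx; apply: h.
by split=> // /nAx.
Qed.

Lemma ray_preimage (X : Type) (S : set_system X) (Z : X -> R) : sigma_algebra setT S ->
  (forall r, S [set x | (r < Z x)%R]) ->
  preimage_set_system setT Z (measurable : set (set time)) `<=` S.
Proof.
move=> sS SZ _ [B mB <-]; rewrite setTI.
have : (@RGenOInfty.G R).-sigma.-measurable B by rewrite -RGenOInfty.measurableE.
suff h : <<s (@RGenOInfty.G R) >> `<=` [set B | S (Z @^-1` B)] by exact: h.
apply: smallest_sub.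
- split => /=; first by rewrite preimage_set0; case: sS.
  + by move=> A SA; rewrite setTD preimage_setC; exact: sigma_algebra_setC.
  + by move=> A SA; rewrite preimage_bigcup; exact: (sigma_algebra_countU sS).
- move=> _ [r ->] /=; rewrite (_ : _ @^-1` _ = [set x | (r < Z x)%R])//.
  by apply/seteqP; split=> x /=; rewrite in_itv /= andbT.
Qed.

(* Since [grid n t] tends to t from strictly above, a right continuous process is
   recovered from its values at these rational times. *)
Let grid (n : nat) (t : R) : rat := ((Num.floor (t * n.+1%:R) + 1)%:~R / n.+1%:R)%R.

Let ratr_grid n t : ratr (grid n t) = ((Num.floor (t * n.+1%:R) + 1)%:~R / n.+1%:R)%R :> R.
Proof. by rewrite fmorph_div /= ratr_int ratr_nat. Qed.

Let lt_grid n t : (t < ratr (grid n t))%R.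
Proof. by rewrite ratr_grid ltr_pdivlMr ?ltr0n// floorD1_gt. Qed.

Let grid_le n t : (ratr (grid n t) <= t + n.+1%:R^-1)%R.
Proof.
rewrite ratr_grid ler_pdivrMr ?ltr0n// mulrDl mulVf ?pnatr_eq0//.
by rewrite intrD lerD2r; apply: floor_le_tmp.
Qed.

(** By right continuity, [Z > r] at [t] if and only if, for some [j], [Z] is at least
    [r + 1 / (j + 1)] at all [grid n t] with [n] large. Only countably many variables occur, those
    at rational times; each event is replaced by one of the uncompleted filtration, and the
    exceptional paths form a null set independent of [t]. *)
Lemma copredictablem_fiber_eq :
  copredictablem Q `<=` [set A | exists2 B, rect_sigma G B & fiber_eq Q snd A B].
Proof.
have sR := rect_sigma_algebra G.
apply: smallest_sub; first exact: sigma_algebra_fiber_eq.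
move=> A [Z [mZ aZ rZ _]]; apply: ray_preimage A; first exact: sigma_algebra_fiber_eq.
move=> r.
have hH (sj : rat * nat) : exists H, G (ratr sj.1) H /\
    fiber_eq Q id [set w | (r + sj.2.+1%:R^-1 <= Z (ratr sj.1, w))%R] H.
  have [H GH hH] : exists2 H, G (ratr sj.1) H &
      fiber_eq Q id [set w | (r + sj.2.+1%:R^-1 <= Z (ratr sj.1, w))%R] H.
    apply: Gm_after_fiber_eq; apply: aZ.
    exists `[(r + sj.2.+1%:R^-1)%R, +oo[%classic; first exact: measurable_itv.
    by rewrite setTI; apply/seteqP; split=> w /=; rewrite in_itv /= andbT.
  by exists H.
have [H {}hH] := choice hH.
(* [grid n] is constant on each cell, with value the excluded right end [node n k]; an event of [G]
   at that end times the cell is therefore in [rect_sigma]. *)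
pose cell (n : nat) (k : int) : set R :=
  [set t | (k%:~R / n.+1%:R <= t < (k + 1)%:~R / n.+1%:R)%R].
pose node (n : nat) (k : int) : rat := ((k + 1)%:~R / n.+1%:R)%R.
have ratr_node n k : ratr (node n k) = ((k + 1)%:~R / n.+1%:R)%R :> R.
  by rewrite fmorph_div /= ratr_int ratr_nat.
pose step j n : set (R * W) := \bigcup_k [set z | cell n k z.1 /\ H (node n k, j) z.2].
exists (\bigcup_j \bigcup_N \bigcap_n (if (n < N)%N then setT else step j n)).
  apply: (sigma_algebra_countU sR) => j; apply: (sigma_algebra_countU sR) => N.
  apply: (sigma_algebra_countI sR) => n; case: ifP => _; first exact: (sigma_algebra_setT sR).
  apply: (sigma_algebra_countU sR) => k; apply: rect_sigma_halfopen => t tk.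
  apply: G0_after_decr (hH (node n k, j)).1; rewrite ratr_node; exact: ltW.
have stepE j n t w : step j n (t, w) <-> H (grid n t, j) w.
  have n0 : (0 < n.+1%:R :> R)%R by rewrite ltr0n.
  split=> [[k _ [/= /andP[k1 k2] Hk]]|Hg]; last first.
    exists (Num.floor (t * n.+1%:R)) => //; split => //=; rewrite /cell /=.
    by rewrite ler_pdivrMr// ltr_pdivlMr// floor_le_tmp floorD1_gt.
  suff -> : grid n t = node n k by [].
  rewrite /grid /node; congr ((_ + 1)%:~R / _)%R; apply: floor_def.
  by rewrite -ler_pdivrMr// -ltr_pdivlMr// k1.
apply: (negligibleS _ (negligibleU rZ (negligible_countU (fun sj => (hH sj).2)))).
move=> w [[t w'] /= -> h]; apply: contrapT => /not_orP[/contrapT /= rw nH]; apply: h.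
have {}nH s j : (r + j.+1%:R^-1 <= Z (ratr s, w))%R <-> H (s, j) w.
  by apply: contrapT => h; apply: nH; exists (s, j) => //; exists w.
have := rw t => rt; split=> [rZt|[j _ [N _ hN]]].
  have [j hj] : exists j : nat, (r + j.+1%:R^-1 < Z (t, w))%R.
    exists (Num.trunc (Z (t, w) - r)^-1); rewrite -ltrBrDl.
    have Zr : (0 < Z (t, w) - r)%R by rewrite subr_gt0.
    rewrite -[ltRHS]invrK ltf_pV2 ?posrE ?invr_gt0//; exact: truncnS_gt.
  have [e /= e0 he] : \forall s \near t^'+, (r + j.+1%:R^-1 < Z (s, w))%R.
    exact: (cvgr_gt _ rt).
  exists j => //; exists (Num.trunc e^-1) => // n _; case: ifPn => //.
  rewrite -leqNgt => en; apply/stepE/nH/ltW; apply: he; last exact: lt_grid.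
  rewrite /= distrC ger0_norm ?subr_ge0 ?ltW ?lt_grid//.
  rewrite ltrBlDl (le_lt_trans (grid_le _ _))// ltrD2l.
  rewrite -[ltRHS]invrK ltf_pV2 ?posrE ?invr_gt0// (lt_le_trans (truncnS_gt _))//.
  by rewrite ler_nat ltnS.
apply: contrapT => /= /negP; rewrite -leNgt => Zr.
have [e /= e0 he] : \forall s \near t^'+, (Z (s, w) < r + j.+1%:R^-1)%R.
  by apply: (cvgr_lt _ rt); rewrite (le_lt_trans Zr)// ltrDl invr_gt0.
pose n := maxn N (Num.trunc e^-1).
have := hN n I; rewrite ltnNge leq_maxl /= => /stepE/nH.
rewrite leNgt => /negP; apply; apply: he; last exact: lt_grid.
rewrite /= distrC ger0_norm ?subr_ge0 ?ltW ?lt_grid//.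
rewrite ltrBlDl (le_lt_trans (grid_le _ _))// ltrD2l.
rewrite -[ltRHS]invrK ltf_pV2 ?posrE ?invr_gt0// (lt_le_trans (truncnS_gt _))//.
by rewrite ler_nat ltnS leq_maxr.
Qed.

Lemma copredictable0_sub : @copredictable0 R E `<=` copredictablem Q.
Proof.
apply: sub_sigma_algebra2 => A [Z [mZ aZ rZ vZ] ZA]; exists Z => //; split => //.
- have mid : measurable_fun [set: g_sigma_algebraType (Gm Q)] (id : _ -> kuz).
    move=> _ Y mY; rewrite setTI; apply: sub_sigma_algebra; exists Y => //.
    by exists set0; [exact: negligible_set0|rewrite setU0].
  have mp : measurable_fun [set: time * g_sigma_algebraType (Gm Q)]
      (fun z => (z.1, z.2) : time * kuz).
    apply: measurable_fun_pair; first exact: measurable_fst.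
    exact: (measurableT_comp mid measurable_snd).
  have := measurableT_comp mZ mp.
  by apply: eq_measurable_fun => -[].
- by move=> t B /aZ GB; apply: sub_sigma_algebra; left.
- exact: aeW.
Qed.

Lemma copredictable0_measurable : @copredictable0 R E `<=` (measurable : set_system (time * kuz)).
Proof.
apply: smallest_sub; first exact: sigma_algebra_measurable.
by move=> A [Z [mZ _ _ _] [B mB <-]]; exact: mZ.
Qed.

Lemma Mm_fiber_eq :
  Mm Q `<=` [set A | exists2 B, measurable (B : set (time * kuz)) & fiber_eq Q snd A B].
Proof.
apply: smallest_sub.
  by apply: sigma_algebra_fiber_eq; exact: sigma_algebra_measurable.
move=> _ [Z [Z' mZ' ZZ'] [B mB <-]]; exists (Z' @^-1` B).
  by have := mZ' measurableT B mB; rewrite setTI.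
apply: negligibleS ZZ' => w [[t w'] /= -> h] ZZ; apply: h.
by split=> [[_ ZB]|ZB]; [rewrite /preimage /= -ZZ|split=> //; rewrite /preimage /= ZZ].
Qed.

End up_to_evanescence.

(** * Completion and localization *)

Section completion.
Context {R : realType} {E : ptopologicalType}.
Local Notation W := (kuznetsov_path R E).
Local Notation time := (measurableTypeR R).
Local Notation kuz := (kuznetsov_space R E).
Local Notation G := (@G0_after R E).
Variable Q : {measure set kuz -> \bar R}.
Local Notation Wc := (caratheodory_type (mu_ext Q)).
Local Notation Qc := (@completed_measure_extension _ _ _ Q).

Lemma completion_measurable (A : set W) :
  measurable (A : set kuz) -> measurable (A : set Wc).
Proof. exact: caratheodory_measurable_mu_ext. Qed.

Lemma completionE (A : set W) : measurable (A : set kuz) -> Qc A = Q A.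
Proof. by move=> mA; rewrite /completed_measure_extension measurable_mu_extE. Qed.

Lemma negligible_completion (N : set W) : Q.-negligible N ->
  measurable (N : set Wc) /\ Qc N = 0.
Proof.
move=> [M [mM M0 NM]].
have N0 : Qc N = 0.
  apply/eqP; rewrite eq_le measure_ge0 andbT -M0 -completionE//.
  exact: le_mu_ext.
split=> //; apply: measure_is_complete_caratheodory; exists M; split => //.
  exact: completion_measurable.
by rewrite -M0; exact: completionE.
Qed.

Lemma completion_eq_up_to (A B : set W) : measurable (B : set Wc) ->
  Q.-negligible [set w | ~ (A w <-> B w)] -> measurable (A : set Wc).
Proof.
move=> mB nAB; pose D := [set w | ~ (A w <-> B w)].
have sub (C : set W) : C `<=` D -> measurable (C : set Wc).
  by move=> CD; apply: (negligible_completion _).1; exact: negligibleS nAB.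
rewrite (_ : A = (B `\` D) `|` (A `&` D)).
  by apply: measurableU; [apply: measurableD => //|]; apply: sub => // w [].
apply/seteqP; split=> w.
  move=> Aw; have [Dw|nD] := pselect (D w); [by right|left; split => //].
  by move/contrapT : nD => h; apply/h.
by case=> [[Bw /contrapT h]|[]//]; apply/h.
Qed.

Lemma completion_process_measurable : measurable_fun [set: time * Wc] (id : _ -> time * kuz).
Proof.
have mid : measurable_fun [set: Wc] (id : _ -> kuz).
  by move=> _ Y mY; rewrite setTI; exact: completion_measurable.
have mp : measurable_fun [set: time * Wc] (fun z => (z.1, z.2) : time * kuz).
  apply: measurable_fun_pair; first exact: measurable_fst.
  exact: (measurableT_comp mid measurable_snd).
by apply: eq_measurable_fun mp => -[].
Qed.

Lemma completion_measurable_set (A : set (R * W)) :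
  measurable (A : set (time * kuz)) -> measurable (A : set (time * Wc)).
Proof.
by move=> mA; have := completion_process_measurable measurableT mA; rewrite setTI.
Qed.

Lemma completion_at_time (A B : set (R * W)) (T : W -> R) :
  measurable_fun [set: Wc] (T : Wc -> time) ->
  measurable (B : set (time * kuz)) -> fiber_eq Q snd A B ->
  measurable (at_time T A : set Wc).
Proof.
move=> mT mB AB; apply: (completion_eq_up_to (B := at_time T B)).
  by apply: (measurable_at_time (W := Wc) mT); exact: completion_measurable_set.
by apply: negligibleS AB => w h; exists (T w, w).
Qed.

Lemma section_G0_after (A : set (R * W)) t : rect_sigma G A -> G t [set w | A (t, w)].
Proof.
have sG := G0_after_sigma_algebra (E := E) t.
suff h : rect_sigma G `<=` [set A | G t [set w | A (t, w)]] by exact: h.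
apply: smallest_sub => /=.
- split => /=; first by case: sG.
  + move=> B GB; rewrite (_ : [set w | _] = ~` [set w | B (t, w)]).
      exact: (sigma_algebra_setC sG GB).
    by apply/seteqP; split=> w // [].
  + by move=> B GB; exact: (sigma_algebra_countU sG GB).
move=> _ [a [b [e [F [e0 GF ->]]]]] /=.
have [/andP[at_ tb]|h] := boolP (a <= t <= b)%R.
  rewrite (_ : [set w | _] = F); last first.
    by apply/seteqP; split=> [w []//|w Fw]; split => //=; rewrite at_.
  by apply: G0_after_decr GF; rewrite (le_trans tb)// lerDl ltW.
rewrite (_ : [set w | _] = set0); first by case: sG.
by rewrite -subset0 => w [/= tab]; rewrite tab in h.
Qed.

Lemma copredictable_time_measurable (T : W -> \bar R) : copredictable_time Q T ->
  measurable_fun [set: Wc] (T : Wc -> _).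
Proof.
move=> /copredictablem_fiber_eq[B sB hB].
apply: (measurability _ (ErealGenCInfty.measurableE R)).
move=> _ [_ [r ->] <-]; rewrite setTI.
apply: (completion_eq_up_to (B := [set w | B (r, w)])).
  by apply: completion_measurable; exact: G0_after_measurable (section_G0_after sB).
apply: negligibleS hB => w h; exists (r, w) => // -[h1 h2]; apply: h => /=.
by rewrite in_itv /= andbT.
Qed.

(** The graph is the set where [t <= T] minus the set where [q <= T] for some rational [q > t]. The
    latter is in [rect_sigma] because the section at [q] is in [G (ratr q)], hence in [G t] for all
    [t < q]. *)
Lemma copredictable_time_graph (T : W -> \bar R) : copredictable_time Q T ->
  exists2 A, rect_sigma G A & A `<=` alive /\
    Q.-negligible [set w | exists t, ~ (A (t, w) <-> T w = t%:E /\ alive (t, w))].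
Proof.
move=> /copredictablem_fiber_eq[B sB hB]; have sR := rect_sigma_algebra G.
pose C := \bigcup_(q : rat) [set z : R * W | (z.1 < ratr q)%R /\ B (ratr q, z.2)].
exists ((B `\` C) `&` alive); last split.
- apply: (sigma_algebra_setI sR); last exact: rect_sigma_alive.
  apply: (sigma_algebra_setD sR) => //; apply: (sigma_algebra_countU sR) => q.
  apply: (rect_sigma_lt (H := [set w | B (ratr q, w)])) => t tq.
  by apply: G0_after_decr (section_G0_after (t := ratr q) sB); exact: ltW.
- by move=> z [].
apply: negligibleS hB => w [t h]; apply: contrapT => nB; apply: h.
have BE s : B (s, w) <-> s%:E <= T w.
  apply: contrapT => h; apply: nB; exists (s, w) => //= -[h1 h2]; apply: h.
  by split.
split=> [[[/BE tT nC] al]|[Tt al]]; split => //.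
  apply/eqP; rewrite eq_le tT andbT leNgt; apply/negP => tT'.
  have [s ts sT] : exists2 s : R, (t < s)%R & s%:E <= T w.
    case: (T w) tT' => [s| |]//; first by rewrite lte_fin => ts; exists s.
    by move=> _; exists (t + 1)%R; rewrite ?ltrDl// leey.
  have [q] := rat_in_itvoo ts; rewrite in_itv/= => /andP[tq qs].
  apply: nC; exists q => //; split => //=; apply/BE; apply: le_trans sT.
  by rewrite lee_fin ltW.
split; first by apply/BE; rewrite Tt.
by move=> [q _ [/= tq /BE]]; rewrite Tt lee_fin leNgt tq.
Qed.

Lemma eq_integral_up_to (A B N : set W) (f : W -> \bar R) :
  measurable (A : set Wc) -> measurable (B : set Wc) -> Q.-negligible N ->
  measurable_fun [set: Wc] (f : Wc -> _) -> (forall w, 0 <= f w) ->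
  (forall w, ~ N w -> (A w <-> B w)) ->
  \int[Qc]_(w in A) f w = \int[Qc]_(w in B) f w.
Proof.
move=> mA mB /negligible_completion[mN N0] mf f0 AB.
rewrite (ge0_negligible_integral (mu := Qc) mN mA _ _ N0)//; last exact: measurable_funTS.
rewrite [RHS](ge0_negligible_integral (mu := Qc) mN mB _ _ N0)//; last exact: measurable_funTS.
by congr integral; apply/seteqP; split=> w [+ nN]; split => //; exact/AB.
Qed.

End completion.

Section localization.
Context {R : realType} {E : ptopologicalType}.
Local Notation W := (kuznetsov_path R E).
Local Notation kuz := (kuznetsov_space R E).
Local Notation G := (@G0_after R E).

(** A path alive at [t] is in some [B k] at some rational [q > t], and the law of the coordinate at
    [q] gives this event the finite measure [m (B k)]. The indices [n] encode the pairs [(q, k)],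
    and indices coding no pair give the empty set. *)
Lemma alive_localization (P : R -> R.-spker borel E ~> borel E)
    (m : {measure set (borel E) -> \bar R}) (Q : {measure set kuz -> \bar R}) :
  sigma_finite setT m -> kuznetsov_measure P m Q ->
  exists (b : nat -> R) (F : nat -> set W),
    [/\ forall n t, (t < b n)%R -> G t (F n), forall n, Q (F n) < +oo &
        alive = \bigcup_n [set z | (z.1 < b n)%R /\ F n z.2]].
Proof.
move=> [B BT hB] [_ hQ].
pose b n : R := if @unpickle (rat * nat)%type n is Some qk then ratr qk.1 else 0%R.
pose F n : set W := if @unpickle (rat * nat)%type n is Some qk
  then coord (ratr qk.1) @^-1` (Some @` B qk.2) else set0.
exists b, F; split.
- move=> n t; rewrite /b /F; case: unpickle => [[q k]|_]/=.
    by move=> tq; apply: G0_after_coord => //; apply: measurable_Some; case: (hB k).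
  by case: (G0_after_sigma_algebra (E := E) t).
- move=> n; rewrite /F; case: unpickle => [[q k]|]/=; last by rewrite measure0.
  have [mB Bfin] := hB k.
  have := hQ 0%N (fun=> ratr q) (fun=> B k) (fun i => ltac:(by [])) (fun i _ => mB).
  rewrite /= integral_cst// mul1e => QB.
  (* Being in [E] at time [q] puts [q] inside the open lifetime, so the strict bounds by birth and
     death come for free. *)
  rewrite (_ : coord _ @^-1` _ = [set w | [/\ birth w < (ratr q)%:E,
     forall i, (i <= 0)%N -> (Some @` B k) (coord (ratr q) w) & (ratr q)%:E < death w]]).
    by rewrite QB.
  apply/seteqP; split=> [w Bw|w [_ /(_ 0%N) + _]]; last exact.
  have [a [c hac]] := kuznetsov_pathP w.
  have wq : w (ratr q) <> Delta by case: Bw => x _; rewrite /coord => <-.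
  have /andP[aq qc] : a < (ratr q)%:E < c by apply: contrapT => /(hac (ratr q)).2.
  have alive_in s : a < s%:E < c -> w s <> Delta by move=> /(hac s).1[].
  split => //.
    have [s as_ sq] : exists2 s : R, a < s%:E & (s < ratr q)%R.
      case: a {hac alive_in} aq => [a| |]//; last first.
        by move=> _; exists (ratr q - 1)%R; rewrite ?ltNyr// gtrBl.
      rewrite lte_fin => aq; exists ((a + ratr q) / 2)%R; rewrite ?lte_fin.
        lra.
      lra.
    apply: (@le_lt_trans _ _ s%:E); last by rewrite lte_fin.
    apply: ereal_inf_lbound; exists s => //=; apply: alive_in.
    by rewrite as_ (lt_trans _ qc)// lte_fin.
  have [s qs sc] : exists2 s : R, (ratr q < s)%R & s%:E < c.
    case: c {hac alive_in} qc => [c| |]//; last first.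
      by move=> _; exists (ratr q + 1)%R; rewrite ?ltry// ltrDl.
    rewrite lte_fin => qc; exists ((ratr q + c) / 2)%R; rewrite ?lte_fin.
      lra.
    lra.
  apply: (@lt_le_trans _ _ s%:E); first by rewrite lte_fin.
  apply: ereal_sup_ubound; exists s => //=; apply: alive_in.
  by rewrite sc andbT (lt_trans aq)// lte_fin.
- rewrite aliveE; apply/seteqP; split=> [[t w] [q _ [/= tq wq]]|[t w] [n _ [/=]]].
    case wE : (coord (ratr q) w) wq => [x|]// _.
    have [k _ Bx] : (\bigcup_k B k) x by rewrite -BT.
    exists (pickle (q, k)); first exact: I.
    by rewrite /b /F pickleK; split; [exact: tq|exists x].
  rewrite /b /F; case: unpickle => [[q k]|]//= tq [x _ wx].
  by exists q => //; split => //=; rewrite -wx.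
Qed.

End localization.

(** * Gluing over events of finite measure *)

Section existence.
Context {R : realType} {E : ptopologicalType}.
Local Notation W := (kuznetsov_path R E).
Local Notation time := (measurableTypeR R).
Local Notation kuz := (kuznetsov_space R E).
Local Notation G := (@G0_after R E).
Local Notation rect_space := (g_sigma_algebraType (is_rect G)).
Variable Q : {measure set kuz -> \bar R}.
Local Notation Wc := (caratheodory_type (mu_ext Q)).
Local Notation Qc := (@completed_measure_extension _ _ _ Q).
Variables (b : nat -> R) (F : nat -> set W).
Hypotheses (GF : forall n t, (t < b n)%R -> G t (F n)) (QF : forall n, Q (F n) < +oo).
Hypothesis aliveF : alive = \bigcup_n [set z | (z.1 < b n)%R /\ F n z.2].

Let sR := rect_sigma_algebra G.

Lemma kuz_measurable_F n : measurable (F n : set kuz).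
Proof. by apply: (@G0_after_measurable _ _ (b n - 1)%R); apply: GF; rewrite gtrBl. Qed.

Let mF n : measurable (F n : set Wc).
Proof. exact: completion_measurable (kuz_measurable_F n). Qed.

Let Gc t : G t `<=` (measurable : set_system Wc).
Proof. by move=> A GA; apply: completion_measurable; exact: G0_after_measurable GA. Qed.

Definition time_dom (T : W -> \bar R) : set W := [set w | -oo < T w < death w].

Lemma time_domP T (A : set (R * W)) w :
  ~ (exists t, ~ (A (t, w) <-> T w = t%:E /\ alive (t, w))) ->
  time_dom T w <-> at_time (fine \o T) A w.
Proof.
move=> /forallNP h; have {}h t : A (t, w) <-> T w = t%:E /\ alive (t, w).
  by have /contrapT := h t.
rewrite -[at_time _ _ _]/(A (fine (T w), w)) h; split=> [/andP[NT Td]|[TE al]].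
  have Tfin : T w \is a fin_num.
    by rewrite fin_numElt NT (lt_le_trans Td)// leey.
  by split; [rewrite fineK|rewrite /alive /= fineK].
by apply/andP; split; [rewrite TE ltNyr|rewrite TE; exact: al].
Qed.

Lemma measurable_fine_time T : copredictable_time Q T ->
  measurable_fun [set: Wc] (fine \o T : Wc -> time).
Proof. by move=> /copredictable_time_measurable mT; exact: measurableT_comp. Qed.

Lemma measurable_time_dom T : copredictable_time Q T -> measurable (time_dom T : set Wc).
Proof.
move=> cT; have mT := measurable_fine_time cT.
have [A sA [_ nA]] := copredictable_time_graph cT.
apply: (completion_eq_up_to (B := at_time (fine \o T) A)).
  apply: (measurable_at_time (W := Wc) mT); exact: (@rect_sigma_measurable R _ Wc G Gc _ sA).
apply: negligibleS nA => w h; apply: contrapT => nA; apply: h; exact: time_domP.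
Qed.

(** [F n] is known only at times before [b n], so the finite pieces are cut out of [R * W] rather
    than of [W]: the projection for the restriction of the measure to [F n] is used on [D n], after
    the [D n] have been made disjoint. *)
Lemma projection_of_set (A : set (R * W)) : measurable (A : set (time * kuz)) ->
  exists p : R * W -> \bar R, [/\ forall z, 0 <= p z,
    measurable_fun [set: rect_space] (p : rect_space -> _),
    forall z, ~ alive z -> p z = 0 &
    forall T, copredictable_time Q T ->
      Qc (time_dom T `&` at_time (fine \o T) A) =
      \int[Qc]_(w in time_dom T) p (fine (T w), w)].
Proof.
move=> /completion_measurable_set mA; have {}mA := mA Q.
pose mu n := mrestr Qc (mF n).
have mu_fin n : mu n setT < +oo.
  rewrite /mu /mrestr setTI; have -> := completionE Q (kuz_measurable_F n).
  exact: QF.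
have hp n := projects_exists (mu := mu n) (mu_fin n) (@G0_after_sigma_algebra R E)
  (@G0_after_decr R E) Gc mA.
have [p {}hp] := choice hp.
have p0 n z : 0 <= p n z by have [/(_ z)/andP[]] := hp n.
pose D n : set (R * W) := [set z | (z.1 < b n)%R /\ F n z.2].
pose D' := seqDU D.
have sD n : rect_sigma G (D n) by apply: rect_sigma_lt => t; exact: GF.
have sD' n : rect_sigma G (D' n) by exact: (@seqDU_measurable _ rect_space).
pose q n := p n \_ (D' n).
have q0 n z : 0 <= q n z by rewrite /q /patch; case: ifP.
have mq n : measurable_fun [set: rect_space] (q n : rect_space -> _).
  have [_ mp _] := hp n.
  by apply: (measurable_restrictT (p n : rect_space -> _) (sD' n : measurable (_ : set rect_space))).1; exact: measurable_funTS mp.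
exists (fun z => \sum_(n <oo) q n z); split.
- by move=> z; exact: nneseries_ge0.
- apply: (@ge0_emeasurable_sum _ _ _ _ (fun n (z : rect_space) => q n z) predT) => //.
- move=> z nz; apply: eseries0 => n _ _; rewrite /q patchE memNset// => D'z.
  by apply: nz; rewrite aliveF; exists n => //; exact: subset_seqDU D'z.
move=> T cT; have mT := measurable_fine_time cT.
have [C sC [Ca nC]] := copredictable_time_graph cT.
have mdom := measurable_time_dom cT.
have mCT : measurable (at_time (fine \o T) C : set Wc).
  by apply: (measurable_at_time (W := Wc) mT); exact: (@rect_sigma_measurable R _ Wc G Gc _ sC).
have mAT : measurable (at_time (fine \o T) A : set Wc) by exact: (measurable_at_time (W := Wc) mT).
set N := [set w | exists t, _] in nC.
have domC w : ~ N w -> time_dom T w <-> at_time (fine \o T) C w by exact: time_domP.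
have mqT n : measurable_fun [set: Wc] (fun w => q n (fine (T w), w)).
  exact: (@measurable_at R _ Wc G Gc (fine \o T) (q n) mT (mq n)).
have [mN N0] := negligible_completion nC.
have msum : measurable_fun [set: Wc] (fun w => \sum_(n <oo) q n (fine (T w), w)).
  by apply: (@ge0_emeasurable_sum _ _ _ _ (fun n (w : Wc) => q n (fine (T w), w)) predT).
have sum0 (w : Wc) : 0 <= \sum_(n <oo) q n (fine (T w), w) by exact: nneseries_ge0.
rewrite [RHS](eq_integral_up_to mdom mCT nC msum sum0 domC).
rewrite [RHS](integral_nneseries Qc mCT (f := fun n w => q n (fine (T w), w))
  (fun n => measurable_funTS (mqT n)) (fun n w _ => q0 n _)).
have -> : Qc (time_dom T `&` at_time (fine \o T) A) =
    Qc (at_time (fine \o T) C `&` at_time (fine \o T) A).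
  have eq_mu (X : set Wc) : measurable X -> Qc (X `&` at_time (fine \o T) A) =
      \int[Qc]_(w in X) (\1_(at_time (fine \o T) A) w)%:E.
    by move=> mX; rewrite integral_indic// setIC.
  rewrite !eq_mu//; apply: (eq_integral_up_to mdom mCT nC) => //.
  by apply/measurable_EFinP; exact: measurable_indic.
have thinC n : thin (mu n) G (fine \o T) (C `&` D' n).
  split => //; first exact: (sigma_algebra_setI sR).
  exists N; split => //.
    by rewrite /mu /mrestr; apply: (subset_measure0 (mu := Qc)) N0 => //; exact: measurableI.
  move=> t w /forallNP/(_ t)/contrapT h [/h[/= Tt _] _].
  by rewrite /= Tt.
have CE : at_time (fine \o T) C = \bigcup_n at_time (fine \o T) (C `&` D' n).
  rewrite -[RHS]/(at_time (fine \o T) (\bigcup_n (C `&` D' n))) -setI_bigcupr.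
  by rewrite -seqDU_bigcup_eq -aliveF setIidl.
have mCD n : measurable (at_time (fine \o T) (C `&` D' n) : set Wc).
  exact: (@thin_measurable R _ Wc (mu n) G Gc _ _ (thinC n)).
rewrite {1}CE setI_bigcupl measure_bigcup//; last 2 first.
- by move=> n _; exact: measurableI.
- apply/trivIsetP => i j _ _ ij; rewrite -subset0 => w [[[_ Di] _] [[_ Dj] _]].
  have /trivIsetP/(_ i j I I ij) := trivIset_seqDU D.
  by rewrite -subset0 => /(_ _ (conj Di Dj)).
rewrite (eq_eseriesl (Q := predT)); last by move=> n; rewrite in_setT.
apply: eq_eseriesr => n _; have [_ _ hpn] := hp n.
(* On this piece the path is in [F n], so the restricted measure and the full one coincide there. *)
have sub : at_time (fine \o T) (C `&` D' n) `<=` F n.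
  by move=> w [_ D'w]; have [] : D n (fine (T w), w) by exact: subset_seqDU D'w.
transitivity (mu n (at_time (fine \o T) (A `&` (C `&` D' n)))).
  rewrite /mu /mrestr; congr (Qc _); apply/seteqP; split=> [w [CDw Aw]|w [[Aw CDw] _]//].
  by split => //; exact: sub.
etransitivity; first exact: (hpn _ _ (thinC n)).
rewrite (eq_measure_integral Qc); last first.
  by move=> X mX XC; rewrite /mu /= /mrestr setIidl// => w /XC /sub.
rewrite (_ : at_time (fine \o T) (C `&` D' n) = at_time (fine \o T) C `&` at_time (fine \o T) (D' n))//.
by rewrite integral_mkcondr; apply: eq_integral => w _; rewrite /q /patch.
Qed.

End existence.

(** * From sets to nonnegative processes *)

Section simple_series.
Import HBNNSimple HBSimple.
Context d (T : measurableType d) (R : realType).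

Lemma nonneg_measurable_series (f : T -> \bar R) : measurable_fun setT f -> (forall x, 0 <= f x) ->
  exists g : nat -> {sfun T >-> R}, (forall n x, 0 <= g n x)%R /\
    forall x, f x = \sum_(n <oo) (g n x)%:E.
Proof.
move=> mf f0; pose h := nnsfun_approx measurableT mf.
pose g n : {sfun T >-> R} := if n is k.+1 then (h k.+1 \- h k)%R else h 0%N.
exists g; split.
  move=> [|n] x /=; first exact: fun_ge0.
  by rewrite subr_ge0; have /lefP := nd_nnsfun_approx measurableT mf (leqnSn n); apply.
move=> x; apply/esym/cvg_lim => //; rewrite -cvg_shiftS.
rewrite (_ : [sequence _]_n = fun n => (h n x)%:E).
  exact: (cvg_nnsfun_approx measurableT mf (fun x _ => f0 x)).
apply/funext => n /=; rewrite sumEFin; congr EFin; rewrite big_mkord.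
elim: n => [|n IH]; first by rewrite big_ord1.
by rewrite big_ord_recr /= IH addrCA subrr addr0.
Qed.

End simple_series.

Section projections.
Import HBNNSimple HBSimple.
Context {R : realType} {E : ptopologicalType}.
Local Notation W := (kuznetsov_path R E).
Local Notation time := (measurableTypeR R).
Local Notation kuz := (kuznetsov_space R E).
Local Notation G := (@G0_after R E).
Variable Q : {measure set kuz -> \bar R}.
Local Notation Wc := (caratheodory_type (mu_ext Q)).
Local Notation Qc := (@completed_measure_extension _ _ _ Q).
Implicit Types Z : R * W -> \bar R.

Lemma process_measurableP (S : set_system (R * W)) Z : sigma_algebra setT S ->
  process_measurable S Z <-> measurable_fun [set: g_sigma_algebraType S] (Z : g_sigma_algebraType S -> _).
Proof.
move=> sS; split=> [mZ _ B mB|mZ _ [B mB <-]].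
  by rewrite /measurable /= sigma_algebra_id//; apply: mZ; exists B.
by have := mZ measurableT B mB; rewrite /measurable /= sigma_algebra_id.
Qed.

Definition product_up_to_evanescence (S : set_system (R * W)) :=
  S `<=` [set A | exists2 B, measurable (B : set (time * kuz)) & fiber_eq Q snd A B].

Lemma copredictable0_product : product_up_to_evanescence (@copredictable0 R E).
Proof.
move=> A cA; exists A; first exact: copredictable0_measurable.
exact: fiber_eq_refl.
Qed.

Lemma process_at_time (S : set_system (R * W)) Z T : product_up_to_evanescence S ->
  process_measurable S Z -> copredictable_time Q T ->
  measurable_fun [set: Wc] (fun w => Z (fine (T w), w)).
Proof.
move=> Sp mZ cT _ B mB; rewrite setTI.
have [|A' mA' AA'] := Sp (Z @^-1` B); first by apply: mZ; exists B => //; rewrite setTI.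
exact: (completion_at_time (measurable_fine_time cT) mA' AA').
Qed.

Lemma Mm_sigma_algebra : sigma_algebra setT (Mm Q).
Proof. exact: smallest_sigma_algebra. Qed.

Definition projection_pair Z pZ := [/\ forall z, 0 <= Z z, process_measurable (Mm Q) Z &
  copredictable_projection Q Z pZ].

Lemma projection_pair_series (Z pZ : nat -> R * W -> \bar R) :
  (forall n, projection_pair (Z n) (pZ n)) ->
  projection_pair (fun z => \sum_(n <oo) Z n z) (fun z => \sum_(n <oo) pZ n z).
Proof.
move=> h; have Z0 n z : 0 <= Z n z by have [] := h n.
have p0 n z : 0 <= pZ n z by have [_ _ []] := h n.
have mZ n : process_measurable (Mm Q) (Z n) by have [] := h n.
have mp n : process_measurable (@copredictable0 R E) (pZ n) by have [_ _ []] := h n.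
have series (S : set_system (R * W)) (X : nat -> R * W -> \bar R) : sigma_algebra setT S ->
    (forall n z, 0 <= X n z) -> (forall n, process_measurable S (X n)) ->
    process_measurable S (fun z => \sum_(n <oo) X n z).
  move=> sS X0 mX; apply/(process_measurableP _ sS).
  apply: (@ge0_emeasurable_sum _ (g_sigma_algebraType S) _ _ X predT) => //.
  by move=> n _; apply/(process_measurableP _ sS).
split.
- by move=> z; exact: nneseries_ge0.
- exact: (series _ _ Mm_sigma_algebra).
split.
- by move=> z; exact: nneseries_ge0.
- exact: (series _ _ copredictable0_sigma_algebra).
- move=> t w dw; apply: eseries0 => n _ _; have [_ _ [_ _ + _]] := h n; exact.
move=> T cT; rewrite /integral_at.
have mdom := measurable_time_dom cT.
rewrite (integral_nneseries Qc mdom (f := fun n w => Z n (fine (T w), w))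
  (fun n => measurable_funTS (process_at_time (@Mm_fiber_eq _ _ Q) (mZ n) cT))
  (fun n w _ => Z0 n _)).
rewrite (integral_nneseries Qc mdom (f := fun n w => pZ n (fine (T w), w))
  (fun n => measurable_funTS (process_at_time copredictable0_product (mp n) cT))
  (fun n w _ => p0 n _)).
by apply: eq_eseriesr => n _; have [_ _ [_ _ _]] := h n; exact.
Qed.

Lemma projection_pair0 : projection_pair (cst 0) (cst 0).
Proof.
split => //; first by apply/(process_measurableP _ Mm_sigma_algebra); exact: measurable_cst.
by split => //; apply/(process_measurableP _ copredictable0_sigma_algebra); exact: measurable_cst.
Qed.

Lemma projection_pairD Z1 Z2 p1 p2 : projection_pair Z1 p1 -> projection_pair Z2 p2 ->
  projection_pair (fun z => Z1 z + Z2 z) (fun z => p1 z + p2 z).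
Proof.
move=> h1 h2.
pose Z n := if n is 0%N then Z1 else if n is 1%N then Z2 else cst 0.
pose p n := if n is 0%N then p1 else if n is 1%N then p2 else cst 0.
have h n : projection_pair (Z n) (p n).
  by case: n => [|[|n]] //; exact: projection_pair0.
have sum2 (u : nat -> \bar R) : (forall n, u n.+2 = 0) -> \sum_(n <oo) u n = u 0%N + u 1%N.
  move=> u0; apply/cvg_lim => //; rewrite -(cvg_shiftn 2)/=.
  rewrite (_ : (fun _ => _) = cst (u 0%N + u 1%N)); first exact: cvg_cst.
  apply/funext => n /=; rewrite addn2 big_nat_recl// big_nat_recl// big1 ?adde0//.
have := projection_pair_series h.
congr projection_pair; apply/funext => z; exact: sum2.
Qed.

Variables (b : nat -> R) (F : nat -> set W).
Hypotheses (GF : forall n t, (t < b n)%R -> G t (F n)) (QF : forall n, Q (F n) < +oo).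
Hypothesis aliveF : alive = \bigcup_n [set z | (z.1 < b n)%R /\ F n z.2].

Lemma rect_copredictable0 (p : R * W -> \bar R) :
  measurable_fun [set: g_sigma_algebraType (is_rect G)] (p : g_sigma_algebraType (is_rect G) -> _) ->
  (forall z, ~ alive z -> p z = 0) -> process_measurable (@copredictable0 R E) p.
Proof.
move=> mp p0 _ [B mB <-]; rewrite setTI; have sC := @copredictable0_sigma_algebra R E.
have pB : copredictable0 (p @^-1` B `&` alive).
  by apply: rect_sigma_copredictable0; have := mp measurableT B mB; rewrite setTI.
(* Sets of [rect_sigma] are known to be copredictable only inside [alive]. Outside, [p] is the
   constant 0, so the preimage contains all of the complement or none of it. *)
have [B0|nB0] := pselect (B 0).
  rewrite (_ : p @^-1` B = (p @^-1` B `&` alive) `|` ~` alive).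
    apply: (sigma_algebra_setU sC) => //; apply: (sigma_algebra_setC sC).
    exact: copredictable0_alive.
  apply/seteqP; split=> [z Bz|z [[]//|na]]; last by rewrite /= p0.
  by have [az|na] := pselect (alive z); [left|right].
rewrite (_ : p @^-1` B = p @^-1` B `&` alive)//.
apply/seteqP; split=> [z Bz|z []//]; split => //; apply: contrapT => na.
by apply: nB0; rewrite -(p0 z).
Qed.

Lemma projection_pair_indic (A : set (R * W)) (c : R) : (0 <= c)%R -> Mm Q A ->
  exists p, projection_pair (fun z => (c * \1_A z)%:E) p.
Proof.
move=> c0 MA; have [A' mA' AA'] := Mm_fiber_eq MA.
have [p [p0 mp pa hp]] := projection_of_set GF QF aliveF mA'.
exists (fun z => c%:E * p z); split.
- by move=> z; rewrite lee_fin mulr_ge0.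
- apply/(process_measurableP _ Mm_sigma_algebra); apply/measurable_EFinP.
  apply: measurable_funM => //; apply: measurable_indic.
  by rewrite /measurable /= sigma_algebra_id//; exact: Mm_sigma_algebra.
have mcp : process_measurable (@copredictable0 R E) p by exact: rect_copredictable0.
split.
- by move=> z; rewrite mule_ge0.
- apply/(process_measurableP _ copredictable0_sigma_algebra).
  by apply: measurable_funeM; apply/(process_measurableP _ copredictable0_sigma_algebra).
- by move=> t w dw; rewrite pa ?mule0// /alive /=; apply/negP; rewrite -leNgt.
move=> T cT; rewrite /integral_at.
have mdom := measurable_time_dom cT.
have mT := measurable_fine_time cT.
have mAT := completion_at_time mT mA' AA'.
have mA'T : measurable (at_time (fine \o T) A' : set Wc).
  exact: (completion_at_time mT mA' (fiber_eq_refl _ _ _)).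
have mpT := process_at_time copredictable0_product mcp cT.
rewrite [RHS](ge0_integralZl_EFin Qc mdom (fun w _ => p0 _) (measurable_funTS mpT) c0).
rewrite -hp//.
transitivity (c%:E * \int[Qc]_(w in time_dom T) (\1_(at_time (fine \o T) A) w)%:E).
  by rewrite -ge0_integralZl_EFin//; apply/measurable_EFinP; exact: measurable_indic.
congr (_ * _); rewrite integral_indic// setIC -[LHS]mul1e -[RHS]mul1e -!integral_cst//; last 2 first.
- exact: measurableI.
- exact: measurableI.
apply: (eq_integral_up_to _ _ AA') => //; try exact: measurableI.
move=> w nN; have h : A (fine (T w), w) <-> A' (fine (T w), w).
  by apply: contrapT => h; apply: nN; exists (fine (T w), w).
by split=> -[dw /h].
Qed.

Lemma projection_pair_exists Z : (forall z, 0 <= Z z) -> process_measurable (Mm Q) Z ->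
  exists pZ, projection_pair Z pZ.
Proof.
move=> Z0 /(process_measurableP _ Mm_sigma_algebra) mZ.
have [g [g0 gE]] := nonneg_measurable_series mZ Z0.
have h n : exists p, projection_pair (fun z => (g n z)%:E) p.
  (* A simple function is the finite sum over its range; the values are nonnegative because they are
     attained by [g n]. *)
  have [p hp] : exists p, projection_pair (fun z => (\sum_(i < size (finmap.enum_fset (fset_set (range (g n)))))
      ((finmap.enum_fset (fset_set (range (g n))))`_i *
      \1_(g n @^-1` [set (finmap.enum_fset (fset_set (range (g n))))`_i]) z))%R%:E) p.
    set s := finmap.enum_fset _.
    have : forall i, (i < size s)%N -> (0 <= s`_i)%R.
      by move=> i /(mem_nth 0%R); rewrite in_fset_set ?inE//= => -[z _ <-].
    elim: (size s) => [_|k IH sk].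
      exists (cst 0); rewrite (_ : (fun _ => _) = cst 0); first exact: projection_pair0.
      by apply/funext => z; rewrite big_ord0.
    have [p1 hp1] := IH (fun i ik => sk i (ltnW ik)).
    have [p2 hp2] : exists p, projection_pair (fun z => (s`_k * \1_(g n @^-1` [set s`_k]) z)%:E) p.
      apply: projection_pair_indic; first exact: sk.
      have := @measurable_sfunP _ _ _ _ (g n) [set s`_k] (measurable_set1 _).
      by rewrite /measurable /= sigma_algebra_id//; exact: Mm_sigma_algebra.
    exists (fun z => p1 z + p2 z).
    rewrite (_ : (fun z => _) = fun z => (\sum_(i < k) (s`_i * \1_(g n @^-1` [set s`_i]) z))%R%:E +
        (s`_k * \1_(g n @^-1` [set s`_k]) z)%:E).
      exact: projection_pairD.
    by apply/funext => z; rewrite big_ord_recr.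
  exists p; move: hp; congr (projection_pair _ p); apply/funext => z.
  by rewrite [in RHS]fimfunEord.
have [p hp] := choice h.
exists (fun z => \sum_(n <oo) p n z).
by have := projection_pair_series hp; congr projection_pair; apply/funext => z; rewrite gE.
Qed.

End projections.

(** * Uniqueness *)

Section last_exit_times.
Context {R : realType} {E : ptopologicalType}.
Local Notation W := (kuznetsov_path R E).
Local Notation kuz := (kuznetsov_space R E).
Local Notation G := (@G0_after R E).

Lemma rect_sigma_last_exit (K : set (R * W)) : rect_union G K ->
  rect_sigma G [set z | exists2 s, (z.1 <= s)%R & K (s, z.2)].
Proof.
have sR := rect_sigma_algebra G.
elim=> [|A {}K [a [b [e [F [e0 GF ->]]]]] _ IH].
  by rewrite (_ : [set _ | _] = set0) -?subset0 => [|z []//]; case: sR.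
rewrite (_ : [set _ | _] = [set z | (a <= b)%R /\ (z.1 <= b)%R /\ F z.2] `|`
   [set z | exists2 s, (z.1 <= s)%R & K (s, z.2)]).
  apply: (sigma_algebra_setU sR) => //; have [ab|ba] := boolP (a <= b)%R; last first.
    by rewrite (_ : [set _ | _] = set0) -?subset0 => [|z []//]; case: sR.
  rewrite (_ : [set _ | _] = \bigcup_(n : nat) rect (- n%:R) b F).
    by apply: (sigma_algebra_countU sR) => n; apply: sub_sigma_algebra; exists (- n%:R)%R, b, e, F.
  apply/seteqP; split=> [[t w] [_ [/= tb Fw]]|[t w] [n _ [/= /andP[_ tb] Fw]]]//.
  exists (Num.trunc `|t|).+1 => //; split => //=; rewrite tb andbT.
  by rewrite lerNl ltW// (le_lt_trans (ler_norm _))// normrN truncnS_gt.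
apply/seteqP; split=> [z [s ts [[/= /andP[as_ sb] Fw]|Kw]]|z [[ab [tb Fw]]|[s ts Ks]]].
- by left; split; [exact: le_trans sb|split => //; exact: le_trans sb].
- by right; exists s.
- by exists b => //; left; split=> //=; rewrite ab lexx.
- by exists s => //; right.
Qed.

Variable Q : {measure set kuz -> \bar R}.
Variable K : nat -> set (R * W).
Hypotheses (rK : forall n, rect_union G (K n)) (Kd : {homo K : m n / (m <= n)%N >-> n `<=` m}).
Hypothesis Ka : \bigcap_n K n `<=` alive.

Definition last_exit (w : W) : \bar R :=
  ereal_sup [set t%:E | t in [set t : R | forall n, K n (t, w)]].

(** The section is compact, so its supremum is a maximum; this is why the graph of the last exit
    time lies in the intersection. *)
Lemma last_exit_attained w : shadow (\bigcap_n K n) w ->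
  exists2 t, last_exit w = t%:E & forall n, K n (t, w).
Proof.
move=> [t Kt]; pose S := [set t : R | forall n, K n (t, w)].
have SE : S = \bigcap_n [set t | K n (t, w)].
  by apply/seteqP; split=> s Ks n => [_|]; exact: Ks.
have cS : compact S.
  apply: (subclosed_compact _ (rect_union_compact (w := w) (rK 0%N))); last by move=> s; exact.
  rewrite SE; apply: closed_bigI => n _.
  by apply: compact_closed; [exact: norm_hausdorff|exact: rect_union_compact].
have ci : {within S, continuous (id : R -> R)} by apply: continuous_subspaceT => x; exact: cvg_id.
have [|s Ss sS] := compact_EVT_max _ cS ci.
  by exists t => n; exact: Kt.
rewrite inE in Ss; exists s => //; apply/eqP; rewrite eq_le; apply/andP; split.
  apply: ge_ereal_sup => _ [u Ku <-]; rewrite lee_fin; apply: sS.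
  by rewrite inE.
by apply: ereal_sup_ubound; exists s.
Qed.

Lemma last_exit_not_shadow w : ~ shadow (\bigcap_n K n) w -> last_exit w = -oo.
Proof.
move=> nS; rewrite /last_exit (_ : [set _ | _ in _] = set0) ?ereal_sup0//.
by rewrite -subset0 => x [t Kt _]; apply: nS; exists t => n _; exact: Kt.
Qed.

Lemma time_dom_last_exit : time_dom last_exit = shadow (\bigcap_n K n).
Proof.
apply/seteqP; split=> [w /andP[NT _]|w Sw].
  by apply: contrapT => /last_exit_not_shadow T; rewrite T ltxx in NT.
have [t TE Kt] := last_exit_attained Sw; rewrite /time_dom /= TE ltNyr /=.
by have : alive (t, w) by apply: Ka => n _; exact: Kt.
Qed.

(** [t <= last_exit] holds exactly when every [K n] is met at or after [t], by compactness, and each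
    of these conditions is in [rect_sigma]. Intersecting with [alive] is harmless, since the
    intersection of the [K n] lies in it and survival at a time implies survival before. *)
Lemma copredictable_time_last_exit : copredictable_time Q last_exit.
Proof.
apply: copredictable0_sub; have sC := @copredictable0_sigma_algebra R E.
rewrite (_ : [set z | _] =
    \bigcap_n ([set z : R * W | exists2 s, (z.1 <= s)%R & K n (s, z.2)] `&` alive)).
  apply: (sigma_algebra_countI sC) => n; apply: rect_sigma_copredictable0.
  exact: rect_sigma_last_exit.
apply/seteqP; split=> [[t w] /= tT n _|[t w] h].
  have [Sw|nS] := pselect (shadow (\bigcap_n K n) w); last first.
    by move: tT; rewrite last_exit_not_shadow// leeNy_eq.
  have [s TE Ks] := last_exit_attained Sw; move: tT; rewrite TE lee_fin => ts.
  split; first by exists s.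
  by apply: (@le_lt_trans _ _ s%:E); [rewrite lee_fin|apply: (Ka (_ : (\bigcap_n K n) (s, w))) => i _; exact: Ks].
have [n|s ts Ks] := rect_union_bigcap (t := t) (w := w) rK Kd.
  by have [[s ts Ks] _] := h n I; exists s.
apply: (@le_trans _ _ s%:E); first by rewrite lee_fin.
by apply: ereal_sup_ubound; exists s.
Qed.

End last_exit_times.

Section uniqueness.
Context {R : realType} {E : ptopologicalType}.
Local Notation W := (kuznetsov_path R E).
Local Notation kuz := (kuznetsov_space R E).
Local Notation G := (@G0_after R E).
Variable Q : {measure set kuz -> \bar R}.
Local Notation Wc := (caratheodory_type (mu_ext Q)).
Local Notation Qc := (@completed_measure_extension _ _ _ Q).
Variables (b : nat -> R) (F : nat -> set W).
Hypotheses (GF : forall n t, (t < b n)%R -> G t (F n)) (QF : forall n, Q (F n) < +oo).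
Hypothesis aliveF : alive = \bigcup_n [set z | (z.1 < b n)%R /\ F n z.2].

Variables X Y : R * W -> \bar R.
Hypotheses (X0 : forall z, 0 <= X z) (Y0 : forall z, 0 <= Y z).
Hypotheses (mX : process_measurable (@copredictable0 R E) X)
  (mY : process_measurable (@copredictable0 R E) Y).
Hypothesis XY : forall T, copredictable_time Q T -> integral_at Q X T = integral_at Q Y T.

Let gap (q r : rat) n : set (R * W) :=
  [set z | X z <= (ratr q)%:E /\ (ratr r)%:E <= Y z] `&` (alive `&` [set z | (z.1 < b n)%R /\ F n z.2]).

Let copredictable0_gap q r n : copredictable0 (gap q r n).
Proof.
have sC := @copredictable0_sigma_algebra R E.
apply: (sigma_algebra_setI sC).
  rewrite (_ : [set z | _] = X @^-1` `]-oo, (ratr q)%:E]%classic `&` Y @^-1` `[(ratr r)%:E, +oo[%classic).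
    apply: (sigma_algebra_setI sC).
      by apply: mX; exists `]-oo, (ratr q)%:E]%classic; rewrite ?setTI//; exact: emeasurable_itv.
    by apply: mY; exists `[(ratr r)%:E, +oo[%classic; rewrite ?setTI//; exact: emeasurable_itv.
  by apply/seteqP; split=> z /=; rewrite !in_itv /= ?andbT.
rewrite setIC; apply: rect_sigma_copredictable0; apply: rect_sigma_lt => t; exact: GF.
Qed.

(** If the gap were not negligible, a last exit time would have its graph in it, up to a null set,
    and a domain [N] with [0 < Q N < +oo]. The equality of the two integrals would then give
    [r Q N <= q Q N]. *)
Let gap_negligible q r n : (0 <= q < r)%R -> Q.-negligible (shadow (gap q r n)).
Proof.
move=> /andP[q0 qr]; have sR := rect_sigma_algebra G.
have mF := kuz_measurable_F GF n.
have [A sA hA] := copredictablem_fiber_eq (copredictable0_sub (Q := Q) (copredictable0_gap q r n)).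
(* The approximation [A] of the gap may stick out over a null set of paths; cutting it again keeps
   the section inside [alive] and over [F n] for every path. *)
pose A' := A `&` (alive `&` [set z | (z.1 < b n)%R /\ F n z.2]).
have sA' : rect_sigma G A'.
  apply: (sigma_algebra_setI sR) => //; apply: (sigma_algebra_setI sR).
    exact: rect_sigma_alive.
  by apply: rect_sigma_lt => t; exact: GF.
pose mu := mrestr Q mF.
have mu_fin : mu setT < +oo by rewrite /mu /mrestr setTI; exact: QF.
have A'F : shadow A' `<=` F n by move=> w [t [_ [_ []]]].
have [cap0|cap0] := eqVneq (shadow_capacity mu A') 0.
  have [B [mB AB B0]] := shadow_capacity0 cap0.
  (* [mu] sees only [F n], and the projection of [A'] is contained in [F n]. *)
  apply: (negligibleS _ (negligibleU hA (_ : Q.-negligible (B `&` F n)))); last first.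
    by exists (B `&` F n); split => //; exact: measurableI.
  move=> w [t gt]; have [At|nA] := pselect (A (t, w)).
    have A't : shadow A' w by exists t; split => //; case: gt.
    by right; split; [exact: AB|exact: A'F].
  by left; exists (t, w) => // -[/(_ gt)].
exfalso.
have cap_ge0 : 0 <= shadow_capacity mu A' by apply: le_ereal_inf_tmp => _ [B _ <-].
have cap_fin : shadow_capacity mu A' \is a fin_num.
  rewrite ge0_fin_numE//; apply: le_lt_trans mu_fin; exact: shadow_capacity_le.
have [c c0 cA] : exists2 c : R, (0 < c)%R & c%:E < shadow_capacity mu A'.
  have pos : (0 < fine (shadow_capacity mu A'))%R by rewrite fine_gt0// lt0e cap0 cap_ge0 ltey_eq cap_fin.
  exists (fine (shadow_capacity mu A') / 2)%R; first by rewrite divr_gt0.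
  by rewrite -[ltRHS]fineK// lte_fin ltr_pdivrMr// ltr_pMr// ltr1n.
have [K [rK Kd KA [mN _ cN]]] := rect_sigma_section_measure mu_fin (@G0_after_sigma_algebra R E)
  (@G0_after_decr R E) (@G0_after_measurable R E) sA' cA.
have Ka : \bigcap_n K n `<=` alive by move=> z /KA[_ []].
set N := shadow _ in mN cN.
have NF : N `<=` F n by move=> w [t Kt]; apply: A'F; exists t; exact: KA.
have QN : Qc N = mu N by rewrite completionE// /mu /mrestr setIidl.
have QNfin : Qc N \is a fin_num.
  by rewrite QN ge0_fin_numE//; apply: (finite_mu mu_fin).
have cT := copredictable_time_last_exit (Q := Q) rK Kd Ka.
have mNc : measurable (N : set Wc) := completion_measurable Q mN.
have mXT := process_at_time (@copredictable0_product _ _ Q) mX cT.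
have mYT := process_at_time (@copredictable0_product _ _ Q) mY cT.
have := XY cT; rewrite /integral_at -/(time_dom (last_exit K)) time_dom_last_exit// -/N => XYT.
have [mZ Z0] := negligible_completion hA.
(* The section lies in [A]; off the null set of [hA] it lies in the gap as well, so the bounds on
   [X] and [Y] hold almost everywhere on [N]. *)
have gapN w : N w -> ~ (exists2 x, x.2 = w & ~ (gap q r n x <-> A x)) -> gap q r n (fine (last_exit K w), w).
  move=> Nw nZ; have [t -> Kt] := last_exit_attained rK Nw.
  have [At _] : A' (t, w) by apply: KA => i _; exact: Kt.
  by apply: contrapT => ng; apply: nZ; exists (t, w) => // -[_ /(_ At)].
have up : \int[Qc]_(w in N) X (fine (last_exit K w), w) <= (ratr q)%:E * Qc N.
  rewrite -integral_cst//; apply: ae_ge0_le_integral => //.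
  - exact: measurable_funTS.
  - by move=> w _; rewrite lee_fin ler0q.
  - exists [set w | exists2 x, x.2 = w & ~ (gap q r n x <-> A x)]; split => //.
    move=> w h; apply: contrapT => nZ; apply: h => Nw.
    by have [[]] := gapN w Nw nZ.
have down : (ratr r)%:E * Qc N <= \int[Qc]_(w in N) Y (fine (last_exit K w), w).
  have <- : \int[Qc]_(w in N) (ratr r)%:E = (ratr r)%:E * Qc N by rewrite integral_cst.
  apply: (ae_ge0_le_integral mNc) => [w _||w _||].
  - by rewrite lee_fin ler0q (le_trans q0)// ltW.
  - exact: measurable_cst.
  - exact: Y0.
  - exact: measurable_funTS mYT.
  - exists [set w | exists2 x, x.2 = w & ~ (gap q r n x <-> A x)].
    split; [exact: mZ|exact: Z0|move=> w h; apply: contrapT => nZ; apply: h => Nw].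
    by have [[]] := gapN w Nw nZ.
have := le_trans down (le_trans (_ : _ <= _) up); rewrite XYT => /(_ (lexx _)).
rewrite -(fineK QNfin) -!EFinM lee_fin ler_pM2r; last first.
  by apply: lt_le_trans c0 _; rewrite -lee_fin fineK// QN.
by rewrite ler_rat leNgt qr.
Qed.

Lemma lt_negligible : Q.-negligible (shadow (alive `&` [set z | X z < Y z])).
Proof.
pose N (i : rat * rat * nat) := if (0 <= i.1.1 < i.1.2)%R then shadow (gap i.1.1 i.1.2 i.2) else set0.
have nN i : Q.-negligible (N i).
  by case: i => [[q r] n]; rewrite /N /=; case: ifP => [/gap_negligible//|_]; exact: negligible_set0.
apply: (negligibleS _ (negligible_countU nN)) => w [t [al /= lt]].
have [n _ Fn] : (\bigcup_n [set z : R * W | (z.1 < b n)%R /\ F n z.2]) (t, w) by rewrite -aliveF.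
(* [Y] may be infinite; [X] is then finite and [X + 1] serves as a real number between them. *)
have [y xy yY] : exists2 y : R, X (t, w) < y%:E & y%:E <= Y (t, w).
  case: (Y (t, w)) lt => [y| |]; [by move=> lt; exists y| |by rewrite ltNge leNye].
  move=> lt; have := X0 (t, w); case: (X (t, w)) lt => [x| |]// _ _.
  by exists (x + 1)%R; rewrite ?leey// lte_fin ltrDl.
have [x XE] : exists x, X (t, w) = x%:E.
  by exists (fine (X (t, w))); rewrite fineK// ge0_fin_numE// (lt_trans xy)// ltry.
have x0 : (0 <= x)%R by rewrite -lee_fin -XE.
rewrite XE lte_fin in xy.
have [q] := rat_in_itvoo xy; rewrite in_itv/= => /andP[xq qy].
have [r] := rat_in_itvoo qy; rewrite in_itv/= => /andP[qr ry].
rewrite ltr_rat in qr.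
have q0 : (0 <= q)%R by rewrite -(ler0q R) (le_trans x0)// ltW.
exists (q, r, n) => //; rewrite /N /= q0 qr; exists t; split; last by split.
split=> /=; first by rewrite XE lee_fin ltW.
by rewrite (le_trans _ yY)// lee_fin ltW.
Qed.

End uniqueness.

Theorem theorem3p15 (R : realType) (E : ptopologicalType)
    (P : R -> R.-spker borel E ~> borel E)
    (m : {measure set (borel E) -> \bar R})
    (Q : {measure set (kuznetsov_space R E) -> \bar R})
    (hE : lusin_space R E)
    (hP : borel_right_semigroup P)
    (hm : excessive P m)
    (hQ : kuznetsov_measure P m Q)
    (Z : R * kuznetsov_path R E -> \bar R)
    (hZ0 : forall z, 0 <= Z z)
    (hZ : process_measurable (Mm Q) Z) :
  exists pZ : R * kuznetsov_path R E -> \bar R,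
    copredictable_projection Q Z pZ /\
    forall pZ', copredictable_projection Q Z pZ' -> indistinguishable Q pZ' pZ.
Proof.
have [b [F [GF QF aliveF]]] := alive_localization hm.1 hQ.
have [pZ [_ _ hpZ]] := projection_pair_exists GF QF aliveF hZ0 hZ.
exists pZ; split => // pZ' hpZ'.
have [p0 mp dp hp] := hpZ; have [p'0 mp' dp' hp'] := hpZ'.
have eqT T : copredictable_time Q T -> integral_at Q pZ T = integral_at Q pZ' T.
  by move=> cT; rewrite -hp// -hp'.
have lt1 := lt_negligible GF QF aliveF p0 p'0 mp mp' eqT.
have lt2 := lt_negligible GF QF aliveF p'0 p0 mp' mp (fun T cT => esym (eqT T cT)).
apply: negligibleS (negligibleU lt1 lt2) => w h; apply: contrapT => /not_orP[n1 n2].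
apply: h => t.
have [al|na] := pselect (alive (t, w)); last first.
  have dw : death w <= t%:E by rewrite leNgt; apply/negP.
  by rewrite dp// dp'.
apply/eqP; rewrite eq_le !leNgt; apply/andP; split; apply/negP => lt.
- by apply: n1; exists t.
- by apply: n2; exists t.
Qed.
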